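(* Let $K$ be a constructive field and let $\varphi=(f,g)$ be a $z$-endomorphism of $K\langle x,y,z\rangle$. The following procedure determines whether $\varphi$ is a $z$-tame automorphism. Step 0. If at least one of the polynomials $f,g$ depends on $z$ only, then $\varphi$ is not an automorphism. Step 1. Let $u,v$ be the homogeneous components of highest bidegree of $f,g$, respectively. If both $u,v$ are of bidegree $(1,0)$, i.e. linear, check whether they are linearly independent. If yes, then $\varphi$ is a product of a linear automorphism (from $GL_2(K)$) and a translation $(x+p(z),y+r(z))$. If $u,v$ are linearly dependent, then $\varphi$ is not an automorphism. Step 2. Let $\mathrm{bideg}\,u>(1,0)$ and $\mathrm{bideg}\,u\geq\mathrm{bideg}\,v$. Then $u\in H_l$, $v\in H_k$ for some $k$ and $l$. Check whether $l=kd$ for a positive integer $d$ and decide whether $u=q(v/\beta,z)$ for some $\beta\in K^{\ast}$ and some $q(y,z)\in H_d$. To do this, write $v=\sum_i\theta_i(t_0,\ldots,t_k)\ast u_{i_1}\cdots u_{i_k}$, $u=\sum_j\lambda_j(t_0,\ldots,t_{kd})\ast u_{j_1}\cdots u_{j_{kd}}$ and $q(y,z)=\omega(t_0,t_1,\ldots,t_d)\ast y^d$, where the $u_{i_s},u_{j_s}$ are $x$ or $y$. Here $u$ is known, and $v/\beta$, hence also its polynomial coefficients, is known up to the multiplicative constant $\beta$. Compare some of the nonzero polynomial coefficients $\lambda_j$ of $u$ with the corresponding coefficient of $q(v/\beta,z)$; the product formula for $q(v/\beta,z)$ given in the context allows one to find $\omega(t_0,t_1,\ldots,t_d)$ explicitly,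 up to the value of $\beta^d$, using the usual division of polynomials. If $l=kd$ and $u=q(v/\beta,z)$, replace $\varphi=(f,g)$ with $\varphi_1=(f-q(g/\beta,z),g)$ and apply Step 0 to $\varphi_1$. If $u$ cannot be presented in the desired form, then $\varphi$ is not an automorphism. Step 3. If $\mathrm{bideg}\,v>(1,0)$ and $\mathrm{bideg}\,u<\mathrm{bideg}\,v$, proceed as in Step 2 with the roles of the two coordinates exchanged, replacing $\varphi=(f,g)$ with $\varphi_1=(f,g-q(f/\alpha,z))$ for suitable $q(y,z)$ (with $v=q(u/\alpha,z)$, $\alpha\in K^{\ast}$), and apply Step 0 to $\varphi_1$. If $v$ cannot be presented in this form, then $\varphi$ is not an automorphism.
   Context: $K\langle x,y,z\rangle$ is the free associative $K$-algebra freely generated by $x,y,z$. A $z$-endomorphism (respectively $z$-automorphism) is an endomorphism (respectively automorphism) $\varphi$ of $K\langle x,y,z\rangle$ with $\varphi(z)=z$; it is written $\varphi=(f,g)$ with $f=\varphi(x)$, $g=\varphi(y)$. The $z$-affine automorphisms are those of the form $(\alpha_{11}x+\alpha_{21}y+\alpha_{31}z+\beta_1,\ \alpha_{12}x+\alpha_{22}y+\alpha_{32}z+\beta_2)$ with $\alpha_{ij},\beta_j\in K$ and $(\alpha_{ij})_{i,j=1,2}$ invertible. The $z$-triangular automorphisms are those of the form $(\alpha_1x+p_1(y,z),\ \alpha_2y+p_2(z))$ with $\alpha_1,\alpha_2\in K^{\ast}=K\setminus\{0\}$, $p_1\in K\langle y,z\rangle$, $p_2\in K[z]$. A $z$-automorphism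 is $z$-tame if it belongs to the group generated by the $z$-affine and $z$-triangular automorphisms. Bidegree: a monomial $w$ has $\mathrm{bideg}\,w=(\deg_xw+\deg_yw,\ \deg_zw)$, and bidegrees are ordered lexicographically: $(d_1,e_1)>(d_2,e_2)$ if $d_1>d_2$, or $d_1=d_2$ and $e_1>e_2$. $H_n$ is the subspace of $K\langle x,y,z\rangle$ of all polynomials homogeneous of degree $n$ with respect to $x$ and $y$. The polynomial algebra $K[t_0,t_1,\ldots,t_n]$ acts on $H_n$ by linear extension of $t_0^{b_0}\cdots t_n^{b_n}\ast z^{a_0}u_1z^{a_1}u_2\cdots z^{a_{n-1}}u_nz^{a_n}=z^{a_0+b_0}u_1z^{a_1+b_1}u_2\cdots z^{a_{n-1}+b_{n-1}}u_nz^{a_n+b_n}$, where each $u_i$ is $x$ or $y$; $H_n$ is a free $K[t_0,\ldots,t_n]$-module with basis the $2^n$ monomials $u_1\cdots u_n$. Product formula used in Step 2: if $v=\sum_i\theta_i(t_0,\ldots,t_k)\ast u_{i_1}\cdots u_{i_k}\in H_k$, $q(y,z)=\omega(t_0,\ldots,t_d)\ast y^d\in H_d$ and $\beta\in K^{\ast}$, then $q(v/\beta,z)$ is obtained by applying $\beta^{-d}\,\omega(t_0,t_k,t_{2k},\ldots,t_{dk})$ to the product of the $d$ factors $\sum_i\theta_i(t_{(s-1)k},t_{(s-1)k+1},\ldots,t_{sk})\ast u_{i_1}\cdots u_{i_k}$, $s=1,\ldots,d$, where the variables $t_{(s-1)k},\ldots,t_{sk}$ refer to the positions in the resulting words of degree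 $kd$ in $x,y$.
   Formalization: In Steps 2 and 3, ''φ is not an automorphism'' is replaced by ''φ is not a z-tame automorphism'': the literal claim fails for the Anick automorphism (x+z(xz-zy), y+(xz-zy)z), where u is not of the form q(v/β,z). *)

(* Defs.v *)
From HB Require Import structures.
From mathcomp Require Import all_boot all_order all_algebra finmap.
From mathcomp.multinomials Require Export -(notations) monalg.
From mathcomp.multinomials Require Export mpoly.

Set Implicit Arguments.
Unset Strict Implicit.
Unset Printing Implicit Defensive.

Import Order.TTheory GRing.Theory.
Local Open Scope ring_scope.

(* [monalg] and [mpoly] share several names: unqualified [msupp], [mmap] *)
(* and all notations refer to commutative polynomials; their analogues   *)
(* for the free algebra are written [monalg.msupp], etc.                 *)

Notation letter := 'I_3.
Definition lx : letter := @Ordinal 3 0 isT.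
Definition ly : letter := @Ordinal 3 1 isT.
Definition lz : letter := @Ordinal 3 2 isT.

(* K<x,y,z> : the monoid algebra of the free monoid on three letters *)
Notation freeAlg K := (malg (fmonom 'I_3) K).

(* A word is z^{a_0} u_1 z^{a_1} ... u_n z^{a_n}, with every u_i equal to x *)
(* or y: [xypart] is the sequence of the u_i, [zgaps] the sequence of the   *)
(* n + 1 exponents a_i, and [weave a us] rebuilds the word.                 *)
Definition xypart (w : seq letter) : seq letter := [seq i <- w | i != lz].

Fixpoint zgaps (w : seq letter) : seq nat :=
  if w is i :: w' then
    if i == lz then (head 0 (zgaps w')).+1 :: behead (zgaps w')
    else 0%N :: zgaps w'
  else [:: 0%N].

Fixpoint weave (a : nat -> nat) (us : seq letter) : seq letter :=
  nseq (a 0) lz ++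
    (if us is u :: us' then u :: weave (fun i => a i.+1) us' else [::]).

(* (deg_x w + deg_y w, deg_z w), ordered lexicographically *)
Definition wbideg (w : seq letter) : nat *l nat :=
  (size (xypart w), count_mem lz w).

Section FreeAlgebra.
Variable K : fieldType.
Local Notation A := (freeAlg K).

Definition word (w : seq letter) : A := mkmalgU (FMonom w) 1.
Definition X : A := word [:: lx].
Definition Y : A := word [:: ly].
Definition Z : A := word [:: lz].

(* The z-endomorphism (f, g), i.e. x |-> f, y |-> g, z |-> z *)
Definition zend (fg : A * A) : A -> A :=
  monalg.mmap (in_alg A)
    (fun w : fmonom 'I_3 => \prod_(i <- (w : seq letter)) [:: fg.1; fg.2; Z]`_i).

(* p lies in the subalgebra generated by the letters satisfying S *)
Definition in_letters (S : pred letter) (p : A) : bool :=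
  all (fun w : fmonom 'I_3 => all S w) (monalg.msupp p).
Definition z_only : A -> bool := in_letters (pred1 lz).
Definition yz_only : A -> bool := in_letters (predC1 lx).

Definition z_linear (a : 'M[K]_2) : A * A :=
  (a 0 0 *: X + a 1 0 *: Y, a 0 1 *: X + a 1 1 *: Y).

Definition z_affine (fg : A * A) : Prop :=
  exists (a : 'M[K]_2) (c b : 'rV[K]_2),
    a \in unitmx /\
    fg = ((z_linear a).1 + c 0 0 *: Z + (b 0 0)%:A,
          (z_linear a).2 + c 0 1 *: Z + (b 0 1)%:A).

Definition z_triangular (fg : A * A) : Prop :=
  exists (a1 a2 : K) (p1 p2 : A),
    [/\ a1 != 0, a2 != 0, yz_only p1, z_only p2 &
        fg = (a1 *: X + p1, a2 *: Y + p2)].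

(* The group generated by the z-affine and the z-triangular automorphisms; *)
(* maps are considered up to extensional equality.                         *)
Inductive z_tame : (A -> A) -> Prop :=
| z_tame_affine fg : z_affine fg -> z_tame (zend fg)
| z_tame_triangular fg : z_triangular fg -> z_tame (zend fg)
| z_tame_id : z_tame id
| z_tame_comp phi psi : z_tame phi -> z_tame psi -> z_tame (phi \o psi)
| z_tame_inv phi psi :
    z_tame phi -> cancel phi psi -> cancel psi phi -> z_tame psi
| z_tame_ext phi psi : phi =1 psi -> z_tame phi -> z_tame psi.

(* Junk value (0, 0) at p = 0; no loss, since 0 depends on z only. *)
Definition bideg (p : A) : nat *l nat :=
  \big[Order.max/((0%N, 0%N) : nat *l nat)]_(w <- monalg.msupp p) wbideg w.

(* The homogeneous component of highest bidegree *)
Definition hcomp (p : A) : A :=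
  \sum_(w <- monalg.msupp p | wbideg w == bideg p)
     monalg.mcoeff w p *: mkmalgU w 1.

Definition xydeg (p : A) : nat := (bideg p).1.

(* p \in H_n *)
Definition xyhomog (n : nat) (p : A) : bool :=
  all (fun w : fmonom 'I_3 => size (xypart w) == n) (monalg.msupp p).

(* The action of K[t_0, ..., t_n], meant for h \in H_n *)
Definition tact n (p : {mpoly K[n.+1]}) (h : A) : A :=
  \sum_(m <- msupp p) \sum_(w <- monalg.msupp h)
    (p@_m * monalg.mcoeff w h) *:
      word (weave (fun i => nth 0 (zgaps w) i + m (inord i))%N (xypart w)).

(* The coefficient of h \in H_n, as an element of the free module H_n, *)
(* at the basis element u_1 ... u_n given by us                        *)
Definition tcoef n (us : seq letter) (h : A) : {mpoly K[n.+1]} :=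
  \sum_(w <- monalg.msupp h | xypart w == us)
    monalg.mcoeff w h *: 'X_[ [multinom nth 0%N (zgaps w) i | i < n.+1] ].

Definition lin_indep (u v : A) : Prop :=
  forall a b : K, a *: u + b *: v = 0 -> a = 0 /\ b = 0.

(* q(h, z), for q \in K<y,z> *)
Definition substy (q h : A) : A := zend (X, h) q.

(* u = q(v / b, z) with b <> 0 and q \in H_d, where u \in H_{kd}, v \in H_k *)
(* and d > 0                                                                *)
Definition presents (b : K) (q u v : A) : Prop :=
  exists d : nat,
    [/\ (0 < d)%N, xydeg u = (xydeg v * d)%N, b != 0,
        yz_only q && xyhomog d q & u = substy q (b^-1 *: v)].

(* Division of p by s with respect to the graded order of [mpoly]: leading *)
(* terms are cancelled as long as possible. Each pass lowers the leading   *)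
(* monomial of p, which never leaves 'X_{1..n < msize p}, so that there    *)
(* is enough fuel.                                                         *)
Fixpoint mdiv_loop n (fuel : nat) (p s acc : {mpoly K[n]}) : {mpoly K[n]} :=
  if fuel is fuel'.+1 then
    if (p != 0) && (mlead s <= mlead p)%MM then
      let t := (mleadc p / mleadc s) *: 'X_[mlead p - mlead s] in
      mdiv_loop fuel' (p - t * s) s (acc + t)
    else acc
  else acc.

Definition mdiv n (p s : {mpoly K[n]}) : {mpoly K[n]} :=
  mdiv_loop #|{: 'X_{1..n < msize p}}| p s 0.

(* omega(t_0, t_1, ..., t_d) from omega(t_0, t_k, ..., t_{dk}) *)
Definition contract l k d (p : {mpoly K[l.+1]}) : {mpoly K[d.+1]} :=
  \sum_(m <- msupp p) p@_m *: 'X_[ [multinom m (inord (i * k)) | i < d.+1] ].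

(* Search for q such that u = q(v / b, z). With l = kd, pick a word us for *)
(* which the coefficient lambda of u is nonzero, and cut us into d blocks  *)
(* of length k; by the product formula for q(v / b, z),                    *)
(*   lambda = b^{-d} omega(t_0, t_k, ..., t_{dk}) * theta,                 *)
(*   theta = prod_{s < d} theta_s(t_{sk}, t_{sk+1}, ..., t_{sk+k}),        *)
(* theta_s being the coefficient of v at the s-th block. The omega that    *)
(* results from a division is then tested on all of u.                     *)
Definition find_q (b : K) (u v : A) : option A :=
  let l := xydeg u in
  let k := xydeg v in
  let d := (l %/ k)%N in
  if ~~ ((k %| l)%N && (0 < d)%N) then None else
  let us := head [::] [seq xypart (w : fmonom 'I_3) | w <- monalg.msupp u] in
  let lambda : {mpoly K[l.+1]} := tcoef l us u in
  let theta : {mpoly K[l.+1]} :=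
    \prod_(s < d) (tcoef k (take k (drop (s * k) us)) v
                    \mPo [tuple 'X_(inord (s * k + i)) | i < k.+1]) in
  let q := tact (b ^+ d *: contract k d (mdiv lambda theta)) (Y ^+ d) in
  if u == substy q (b^-1 *: v) then Some q else None.

(* One round of Steps 0-3: either the verdict whether (f, g) is      *)
(* z-tame, or the pair that replaces (f, g). The constant b          *)
(* plays the role of beta in Step 2 and of alpha in Step 3. Linear   *)
(* forms are compared through the determinant of their coefficients. *)
Definition step (b : K) (fg : A * A) : bool + A * A :=
  let: (f, g) := fg in
  let u := hcomp f in
  let v := hcomp g in
  if z_only f || z_only g then inl false
  else if (bideg u == (1%N, 0%N)) && (bideg v == (1%N, 0%N)) then
    inl (monalg.mcoeff (FMonom [:: lx]) u * monalg.mcoeff (FMonom [:: ly]) v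
      != monalg.mcoeff (FMonom [:: ly]) u * monalg.mcoeff (FMonom [:: lx]) v)
  else if (bideg v <= bideg u)%O then
    if find_q b u v is Some q then inr (f - substy q (b^-1 *: g), g)
    else inl false
  else
    if find_q b v u is Some q then inr (f, g - substy q (b^-1 *: f))
    else inl false.

(* At most n rounds, the i-th one with the constant b i *)
Fixpoint run (b : nat -> K) (n : nat) (fg : A * A) : option bool :=
  if n is n'.+1 then
    match step (b 0%N) fg with
    | inl answer => Some answer
    | inr fg' => run (fun i => b i.+1) n' fg'
    end
  else None.

End FreeAlgebra.

Arguments X {K}.
Arguments Y {K}.
Arguments Z {K}.

(* Main.v *)
From HB Require Import structures.
Require Import Defs.
From mathcomp Require Import all_boot all_order all_algebra finmap.
From mathcomp Require Import zify ring.

Set Implicit Arguments.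
Unset Strict Implicit.
Unset Printing Implicit Defensive.

Import Order.TTheory GRing.Theory.
Local Open Scope ring_scope.

(* Every product of z-affine and z-triangular maps can be written x e_q, with  *)
(* e_q = (x + q(y, z), y) and x = (F, G) built from an affine pair by repeatedly *)
(* multiplying on the right by some e_q with bideg q > (1, 0), then by an       *)
(* affine map that mixes the dominant first entry into the second one. Along    *)
(* such a product bidegrees only grow, because the leading component of q(g, z) *)
(* is that of q at that of g. Hence, if a tame pair (f, g) has                  *)
(* bideg g <= bideg f and bideg f > (1, 0), its leading components satisfy      *)
(* u = q(v, z), and the reduction by q lowers the bidegree of f.                *)
(* That q can be computed follows from the product formula: the coefficient of  *)
(* q(v, z) at a word factors as omega(t_0, t_k, ...) times a product of         *)
(* coefficients of v, so omega is found by one exact division; the same factors *)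
(* show that q |-> q(v, z) is injective.                                        *)

(* An abstract presentation of K<x,y,z>. The operations of [freeAlg] are not *)
(* locked, which makes failing conversion tests on its terms intractable, so *)
(* everything is proved for an arbitrary model, whose operations are opaque. *)
(* The definitions fzend, fbideg, etc., unfold to those of Defs.v for the    *)
(* model built from [freeAlg].                                               *)
Record free_model (K : fieldType) := FreeModel {
  fm_alg :> algType K;
  fm_mon : eqType;
  fm_seq : fm_mon -> seq letter;
  fm_mk : seq letter -> fm_mon;
  fm_basis : fm_mon -> fm_alg;
  fm_coef : fm_mon -> fm_alg -> K;
  fm_supp : fm_alg -> seq fm_mon;
  fm_mkK : cancel fm_mk fm_seq;
  fm_seqK : cancel fm_seq fm_mk;
  fm_supp_uniq : forall p, uniq (fm_supp p);
  fm_mem_supp : forall p w, (w \in fm_supp p) = (fm_coef w p != 0);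
  fm_coef_linear : forall w c p q,
    fm_coef w (c *: p + q) = c * fm_coef w p + fm_coef w q;
  fm_coef_basis : forall v w, fm_coef w (fm_basis v) = (v == w)%:R;
  fm_expand : forall p, p = \sum_(w <- fm_supp p) fm_coef w p *: fm_basis w;
  fm_basis_nil : fm_basis (fm_mk [::]) = 1;
  fm_basis_cat : forall s t,
    fm_basis (fm_mk (s ++ t)) = fm_basis (fm_mk s) * fm_basis (fm_mk t) }.

Lemma letterP (H : letter -> Prop) : H lx -> H ly -> H lz -> forall i, H i.
Proof.
move=> Hx Hy Hz [[|[|[|//]]] lt_i].
- by rewrite (_ : Ordinal _ = lx) //; apply: val_inj.
- by rewrite (_ : Ordinal _ = ly) //; apply: val_inj.
- by rewrite (_ : Ordinal _ = lz) //; apply: val_inj.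
Qed.

Section FreeModel.
Variables (K : fieldType) (F : free_model K).
Local Notation A := (fm_alg F).
Local Notation M := (fm_mon F).
Local Notation msup := (@fm_supp K F).
Local Notation "p @[ w ]" := (fm_coef w p) (at level 2, format "p @[ w ]").
Local Notation mseq := (@fm_seq K F).
Implicit Types (p q r f g h u v : A) (c : K) (fg : A * A) (s t : seq letter).
Implicit Types (P Q : pred (seq letter)) (w : M) (V : lmodType K).

Definition fword s : A := fm_basis (fm_mk F s).

Lemma coefD w p q : (p + q)@[w] = p@[w] + q@[w].
Proof. by rewrite -{1}[p]scale1r fm_coef_linear mul1r. Qed.

Lemma coef0 w : (0 : A)@[w] = 0.
Proof. by apply: (addrI (0 : A)@[w]); rewrite -coefD !addr0. Qed.

Lemma coefZ w c p : (c *: p)@[w] = c * p@[w].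
Proof. by rewrite -[c *: p]addr0 fm_coef_linear coef0 addr0. Qed.

Lemma basis_word w : fm_basis w = fword (mseq w).
Proof. by rewrite /fword fm_seqK. Qed.

Lemma coef_word s w : (fword s)@[w] = (s == mseq w)%:R.
Proof. by rewrite fm_coef_basis -(inj_eq (can_inj (@fm_seqK _ F))) fm_mkK. Qed.

Definition wlin V (G : seq letter -> V) p : V :=
  \sum_(w <- msup p) p@[w] *: G (mseq w).

Lemma wlinEw V (G : seq letter -> V) (d : seq M) p :
  uniq d -> {subset msup p <= d} -> wlin G p = \sum_(w <- d) p@[w] *: G (mseq w).
Proof.
move=> Ud sub_d; rewrite [RHS](bigID (fun w => p@[w] != 0)) /= [X in _ + X]big1 => [|w].
  rewrite addr0 -big_filter; apply/perm_big/uniq_perm; rewrite ?fm_supp_uniq ?filter_uniq //.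
  move=> w; rewrite mem_filter -fm_mem_supp.
  by case: (boolP (w \in _)) => //= /sub_d ->.
by rewrite negbK => /eqP->; rewrite scale0r.
Qed.

Lemma wlin_is_linear V (G : seq letter -> V) : linear (wlin G).
Proof.
move=> c p q; pose d := undup (msup (c *: p + q) ++ msup p ++ msup q).
have Ud : uniq d := undup_uniq _.
rewrite !(@wlinEw _ _ d) //.
- rewrite scaler_sumr -big_split /=; apply: eq_bigr => w _.
  by rewrite coefD coefZ scalerDl scalerA.
- by move=> w; rewrite mem_undup !mem_cat => ->; rewrite !orbT.
- by move=> w; rewrite mem_undup !mem_cat => ->; rewrite !orbT.
- by move=> w; rewrite mem_undup !mem_cat => ->.
Qed.

HB.instance Definition _ V (G : seq letter -> V) :=
  GRing.isLinear.Build K A V *:%R (wlin G) (wlin_is_linear G).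

Lemma supp_fword s : msup (fword s) = [:: fm_mk F s].
Proof.
apply: perm_small_eq => //; apply: uniq_perm; rewrite ?fm_supp_uniq // => w.
rewrite fm_mem_supp coef_word inE -[RHS](inj_eq (can_inj (@fm_seqK _ F))) fm_mkK.
by rewrite [RHS]eq_sym; case: (s == _); rewrite ?oner_eq0 ?eqxx.
Qed.

Lemma wlin_word V (G : seq letter -> V) s : wlin G (fword s) = G s.
Proof. by rewrite /wlin supp_fword big_seq1 coef_word fm_mkK eqxx scale1r. Qed.

Lemma linear_wordE V (L : {linear A -> V}) p : L p = wlin (fun s => L (fword s)) p.
Proof.
rewrite {1}[p]fm_expand linear_sum; apply: eq_bigr => w _.
by rewrite linearZ basis_word.
Qed.

Lemma word_nil : fword [::] = 1.
Proof. exact: fm_basis_nil. Qed.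

Lemma word_cat s t : fword (s ++ t) = fword s * fword t.
Proof. exact: fm_basis_cat. Qed.

Lemma word_prod s : fword s = \prod_(i <- s) fword [:: i].
Proof.
elim: s => [|i s IH]; first by rewrite big_nil word_nil.
by rewrite big_cons -IH -word_cat.
Qed.

Definition supp P p : bool := all (fun w => P (mseq w)) (msup p).

Lemma suppP P p : reflect (forall w, p@[w] != 0 -> P (mseq w)) (supp P p).
Proof.
apply: (iffP allP) => H w; first by rewrite -fm_mem_supp; apply: H.
by rewrite fm_mem_supp; apply: H.
Qed.

Lemma supp0 P : supp P 0.
Proof. by apply/suppP => w; rewrite coef0 eqxx. Qed.

Lemma suppD P p q : supp P p -> supp P q -> supp P (p + q).
Proof.
move=> /suppP Pp /suppP Pq; apply/suppP => w; rewrite coefD.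
have [p0|/Pp //] := eqVneq p@[w] 0; have [q0|/Pq //] := eqVneq q@[w] 0.
by rewrite p0 q0 addr0 eqxx.
Qed.

Lemma suppZ P c p : supp P p -> supp P (c *: p).
Proof.
move=> /suppP Pp; apply/suppP => w; rewrite coefZ mulf_eq0 negb_or.
by case/andP=> _ /Pp.
Qed.

Lemma suppN P p : supp P p -> supp P (- p).
Proof. by rewrite -scaleN1r; apply: suppZ. Qed.

Lemma suppB P p q : supp P p -> supp P q -> supp P (p - q).
Proof. by move=> ? ?; rewrite suppD ?suppN. Qed.

Lemma supp_word P s : P s -> supp P (fword s).
Proof. by move=> Ps; rewrite /supp supp_fword /= fm_mkK Ps. Qed.

Lemma supp_sub P Q p : (forall s, P s -> Q s) -> supp P p -> supp Q p.
Proof. by move=> PQ /suppP H; apply/suppP => w /H /PQ. Qed.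

Lemma supp_ind P (H : A -> Prop) :
  H 0 -> (forall p q, H p -> H q -> H (p + q)) -> (forall c p, H p -> H (c *: p)) ->
  (forall s, P s -> H (fword s)) -> forall p, supp P p -> H p.
Proof.
move=> H0 HD HZ Hw p /allP Pp; rewrite [p]fm_expand big_seq.
by elim/big_ind: _ => // w /Pp Pw; apply: HZ; rewrite basis_word; apply: Hw.
Qed.

Lemma supp_predT p : supp predT p.
Proof. exact: all_predT. Qed.

Lemma suppM P Q (R : pred (seq letter)) p q :
  (forall s t, P s -> Q t -> R (s ++ t)) -> supp P p -> supp Q q -> supp R (p * q).
Proof.
move=> PQR Pp Qq; elim/supp_ind: Pp => [|p1 p2 H1 H2|c p1 H1|s Ps].
- by rewrite mul0r supp0.
- by rewrite mulrDl suppD.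
- by rewrite -scalerAl suppZ.
elim/supp_ind: Qq => [|q1 q2 H1 H2|c q1 H1|t Qt].
- by rewrite mulr0 supp0.
- by rewrite mulrDr suppD.
- by rewrite -scalerAr suppZ.
by rewrite -word_cat supp_word // PQR.
Qed.

Lemma wlin_supp V P (G H : seq letter -> V) p :
  (forall s, P s -> G s = H s) -> supp P p -> wlin G p = wlin H p.
Proof. by move=> GH /allP Pp; rewrite /wlin; apply: eq_big_seq => w /Pp /GH ->. Qed.

Lemma linear_supp_eq V (L1 L2 : {linear A -> V}) P p :
  (forall s, P s -> L1 (fword s) = L2 (fword s)) -> supp P p -> L1 p = L2 p.
Proof. by rewrite (linear_wordE L1) (linear_wordE L2); apply: wlin_supp. Qed.

Definition fX : A := fword [:: lx].
Definition fY : A := fword [:: ly].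
Definition fZ : A := fword [:: lz].

Definition fzend fg : A -> A := fun p =>
  \sum_(w <- msup p) in_alg A p@[w] * \prod_(i <- mseq w) [:: fg.1; fg.2; fZ]`_i.

Definition letter_image fg (i : letter) : A := [:: fg.1; fg.2; fZ]`_i.

Lemma zend_wordE fg : fzend fg =1 wlin (fun s => \prod_(i <- s) letter_image fg i).
Proof. by move=> p; apply: eq_bigr => w _; rewrite mulr_algl. Qed.

Fact zend_is_linear fg : linear (fzend fg).
Proof. by move=> c p q; rewrite !zend_wordE linearP. Qed.

HB.instance Definition _ fg :=
  GRing.isLinear.Build K A A *:%R (fzend fg) (zend_is_linear fg).

Lemma zend0 fg : fzend fg 0 = 0.
Proof. exact: linear0. Qed.

Lemma zendD fg p q : fzend fg (p + q) = fzend fg p + fzend fg q.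
Proof. exact: linearD. Qed.

Lemma zendB fg p q : fzend fg (p - q) = fzend fg p - fzend fg q.
Proof. exact: linearB. Qed.

Lemma zend_scale fg c p : fzend fg (c *: p) = c *: fzend fg p.
Proof. exact: linearZ. Qed.

Lemma zend_word fg s : fzend fg (fword s) = \prod_(i <- s) letter_image fg i.
Proof. by rewrite zend_wordE wlin_word. Qed.

Fact zend_is_monoid_morphism fg : monoid_morphism (fzend fg).
Proof.
split; first by have := zend_word fg [::]; rewrite big_nil word_nil.
move=> p q; have pT := supp_predT p; have qT := supp_predT q.
elim/supp_ind: pT => [|p1 p2 H1 H2|c p1 H1|s _].
- by rewrite mul0r zend0 mul0r.
- by rewrite mulrDl !zendD mulrDl H1 H2.
- by rewrite -scalerAl !zend_scale -scalerAl H1.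
elim/supp_ind: qT => [|q1 q2 H1 H2|c q1 H1|t _].
- by rewrite mulr0 zend0 mulr0.
- by rewrite mulrDr !zendD mulrDr H1 H2.
- by rewrite -scalerAr !zend_scale -scalerAr H1.
by rewrite -word_cat !zend_word big_cat.
Qed.

HB.instance Definition _ fg :=
  GRing.isMonoidMorphism.Build A A (fzend fg) (zend_is_monoid_morphism fg).

Lemma zend1 fg : fzend fg 1 = 1.
Proof. exact: rmorph1. Qed.

Lemma zendM fg p q : fzend fg (p * q) = fzend fg p * fzend fg q.
Proof. exact: rmorphM. Qed.

Lemma zendX fg : fzend fg fX = fg.1.
Proof. by rewrite zend_word big_seq1. Qed.

Lemma zendY fg : fzend fg fY = fg.2.
Proof. by rewrite zend_word big_seq1. Qed.

Lemma zendZ fg : fzend fg fZ = fZ.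
Proof. by rewrite zend_word big_seq1. Qed.

Lemma zendE (phi : {lrmorphism A -> A}) : phi fZ = fZ -> phi =1 fzend (phi fX, phi fY).
Proof.
move=> phiZ p; apply: linear_supp_eq (supp_predT p) => s _ /=.
rewrite zend_word word_prod rmorph_prod; apply: eq_bigr => i _.
by elim/letterP: i => //=; rewrite ?phiZ.
Qed.

Lemma zendP (phi : A -> A) : linear phi -> monoid_morphism phi -> phi fZ = fZ ->
  phi =1 fzend (phi fX, phi fY).
Proof.
move=> phiL phiM; exact: (@zendE (HB.pack phi (GRing.isLinear.Build K A A *:%R phi phiL)
  (GRing.isMonoidMorphism.Build A A phi phiM))).
Qed.

Lemma zend_comp fg fg' p :
  fzend fg (fzend fg' p) = fzend (fzend fg fg'.1, fzend fg fg'.2) p.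
Proof.
have E : fzend fg (fzend fg' fZ) = fZ by rewrite !zendZ.
by apply: etrans (@zendE (fzend fg \o fzend fg') E p) _; rewrite /= zendX zendY.
Qed.

Lemma zend_id p : fzend (fX, fY) p = p.
Proof. by apply: esym; apply: (@zendE idfun). Qed.

Definition fz_only := supp (all (pred1 lz)).
Definition fyz_only := supp (all (predC1 lx)).

Lemma zend_z_only fg p : fz_only p -> fzend fg p = p.
Proof.
apply: (@linear_supp_eq _ _ idfun) => s /allP zs /=.
by rewrite zend_word word_prod; apply: eq_big_seq => i /zs /eqP ->.
Qed.

Definition fsubsty q h : A := fzend (fX, h) q.

Lemma zend_yz_only f g q : fyz_only q -> fzend (f, g) q = fsubsty q g.
Proof.
apply: linear_supp_eq => s /allP yzs /=.
by rewrite !zend_word; apply: eq_big_seq => i /yzs; elim/letterP: i.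
Qed.

Lemma z_only_yz_only p : fz_only p -> fyz_only p.
Proof. by apply: supp_sub => s; apply: sub_all => i /eqP ->. Qed.

Lemma zend_supp (S : pred letter) P fg p :
  P [::] -> (forall s t, P s -> P t -> P (s ++ t)) ->
  (forall i, S i -> supp P (letter_image fg i)) ->
  supp (all S) p -> supp P (fzend fg p).
Proof.
move=> P0 Pcat PS; elim/supp_ind => [|p1 p2 H1 H2|c p1 H1|s].
- by rewrite zend0 supp0.
- by rewrite zendD suppD.
- by rewrite zend_scale suppZ.
elim: s => [|i s IH]; first by rewrite word_nil zend1 -word_nil supp_word.
case/andP=> Si Ss; rewrite -cat1s word_cat zendM.
by apply: (suppM Pcat) (IH Ss); rewrite zend_word big_seq1 PS.
Qed.

Lemma substy_yz_only q h : fyz_only q -> fyz_only h -> fyz_only (fsubsty q h).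
Proof.
move=> yq yh; apply: zend_supp yq => // [s t|i]; first by rewrite all_cat => -> ->.
by elim/letterP: i => //= _; rewrite supp_word.
Qed.
End FreeModel.

Arguments fX {K F}.
Arguments fY {K F}.
Arguments fZ {K F}.

(** * Bidegrees *)

Local Notation bdeg := (nat *l nat) (only parsing).

Lemma leqbP (a b : bdeg) :
  (a <= b)%O = (a.1 < b.1)%N || (a.1 == b.1) && (a.2 <= b.2)%N.
Proof.
case: a b => [a1 a2] [b1 b2]; rewrite lexi_pair !leEnat /=.
by case: ltngtP.
Qed.

Lemma ltnbP (a b : bdeg) :
  (a < b)%O = (a.1 < b.1)%N || (a.1 == b.1) && (a.2 < b.2)%N.
Proof.
case: a b => [a1 a2] [b1 b2]; rewrite ltxi_pair !leEnat ltEnat /=.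
by case: (ltngtP a1 b1).
Qed.

Definition badd (a b : bdeg) : bdeg := (a.1 + b.1, a.2 + b.2)%N.

Lemma wbideg_cat s t : wbideg (s ++ t) = badd (wbideg s) (wbideg t).
Proof. by rewrite /wbideg /badd /xypart filter_cat size_cat count_cat. Qed.

Section Bidegree.
Variables (K : fieldType) (F : free_model K).
Local Notation A := (fm_alg F).
Local Notation M := (fm_mon F).
Local Notation msup := (@fm_supp K F).
Local Notation "p @[ w ]" := (fm_coef w p) (at level 2, format "p @[ w ]").
Local Notation mseq := (@fm_seq K F).
Implicit Types (p q r f g h u v : A) (c : K) (fg : A * A) (s t : seq letter).
Implicit Types (P Q : pred (seq letter)) (w : M) (V : lmodType K) (a b : bdeg).

Definition fbideg p : bdeg :=
  \big[Order.max/((0%N, 0%N) : bdeg)]_(w <- msup p) wbideg (mseq w).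

Definition fhcomp p : A :=
  \sum_(w <- msup p | wbideg (mseq w) == fbideg p) p@[w] *: fm_basis w.

Local Notation Hom a := (@supp K F (fun s => wbideg s == a)).
Local Notation Lt a := (@supp K F (fun s => (wbideg s < a)%O)).
Local Notation Le a := (@supp K F (fun s => (wbideg s <= a)%O)).

Definition has_top a u p := [/\ Hom a u, u != 0 & Lt a (p - u)].

Lemma supp_neq0 P p : supp P p -> p != 0 -> exists w, p@[w] != 0 /\ P (mseq w).
Proof.
move=> /suppP Pp p0; case: (boolP (has predT (msup p))) => [/hasP[w]|].
  by rewrite fm_mem_supp => w0 _; exists w; split; last exact: Pp.
rewrite has_predT -eqn0Ngt => /nilP s0.
by move: p0; rewrite [p]fm_expand s0 big_nil eqxx.
Qed.

Lemma wbideg_le_bideg w p : p@[w] != 0 -> (wbideg (mseq w) <= fbideg p)%O.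
Proof. by rewrite -fm_mem_supp => wp; apply: (@le_bigmax_seq _ _ _ _ _ w predT (fun w => wbideg (mseq w)) wp). Qed.

Lemma bideg_le a p : Le a p -> (fbideg p <= a)%O.
Proof.
move=> /allP Lp; rewrite /fbideg big_seq; elim/big_ind: _ => [|x y|w /Lp //].
  by rewrite leqbP; case: a {Lp} => [[|a1] a2].
by rewrite ge_max => -> ->.
Qed.

Lemma has_topE a u p : has_top a u p -> fbideg p = a /\ fhcomp p = u.
Proof.
case=> Hu u0 /suppP Lr.
have coefE w : p@[w] != 0 -> (wbideg (mseq w) <= a)%O.
  rewrite -[p](subrK u) coefD; have [->|/Lr /ltW //] := eqVneq (p - u)@[w] 0.
  by rewrite add0r => /(suppP _ _ Hu) /eqP ->.
have top w : wbideg (mseq w) = a -> p@[w] = u@[w].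
  move=> wa; rewrite -[in LHS](subrK u p) coefD.
  by have [->|/Lr] := eqVneq (p - u)@[w] 0; rewrite ?add0r // wa ltxx.
have pa : fbideg p = a.
  apply: le_anti; rewrite bideg_le /=; last by apply/suppP.
  have [w [w0 /eqP wa]] := supp_neq0 Hu u0.
  by rewrite -wa wbideg_le_bideg // top.
split=> //; rewrite /fhcomp pa [RHS]fm_expand big_mkcond /=.
set G := fun s => if wbideg s == a then fword F s else 0.
transitivity (wlin G p).
  apply: eq_bigr => w _; rewrite /G basis_word; by case: ifP => // _; rewrite scaler0.
rewrite -[p](subrK u) linearD /=.
have -> : wlin G (p - u) = 0.
  rewrite (@wlin_supp _ _ _ (fun s => (wbideg s < a)%O) G (fun=> 0)).
  - by rewrite /wlin big1 // => w _; rewrite scaler0.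
  - by move=> s /lt_eqF; rewrite /G => ->.
  - exact/suppP/Lr.
rewrite add0r.
apply: eq_big_seq => w; rewrite fm_mem_supp => /(suppP _ _ Hu) wa.
by rewrite /G wa basis_word.
Qed.

Lemma bideg_attained p : p != 0 -> exists w, p@[w] != 0 /\ wbideg (mseq w) = fbideg p.
Proof.
move=> p0.
have : fbideg p = (0%N, 0%N) \/ exists w, p@[w] != 0 /\ wbideg (mseq w) = fbideg p.
  rewrite /fbideg big_seq; elim/big_ind: _ => [|x y Hx Hy|w]; first by left.
    by rewrite /Order.max; case: ifP.
  by rewrite fm_mem_supp => w0; right; exists w.
case=> // b0; have [w [w0 _]] := supp_neq0 (supp_predT p) p0.
exists w; split=> //; apply: le_anti; rewrite wbideg_le_bideg //= b0.
by rewrite leqbP; case: (wbideg _) => [[|?] ?].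
Qed.

Lemma has_topP p : p != 0 -> has_top (fbideg p) (fhcomp p) p.
Proof.
move=> p0; set a := fbideg p.
set G := fun s => if wbideg s == a then fword F s else 0.
have hE : fhcomp p = wlin G p.
  rewrite /fhcomp big_mkcond; apply: eq_bigr => w _.
  by rewrite /G basis_word; case: ifP => // _; rewrite scaler0.
have cE w : (fhcomp p)@[w] = if wbideg (mseq w) == a then p@[w] else 0.
  rewrite hE; have pT := supp_predT p.
  elim/supp_ind: pT => [|p1 p2 H1 H2|c p1 H1|s _].
  - by rewrite linear0 coef0 if_same.
  - by rewrite linearD !coefD H1 H2; case: ifP; rewrite ?addr0.
  - by rewrite linearZ !coefZ H1; case: ifP; rewrite ?mulr0.
  rewrite wlin_word /G coef_word; have [->|ne] := eqVneq s (mseq w).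
    by case: ifP; rewrite ?coef0 // coef_word eqxx.
  by rewrite !if_same; case: ifP; rewrite ?coef0 // coef_word (negbTE ne).
split.
- apply/suppP => w; rewrite cE; by case: ifP; rewrite ?eqxx.
- have [w [w0 wa]] := bideg_attained p0.
  by apply: contraNneq w0 => h0; have := cE w; rewrite wa eqxx h0 coef0 => <-.
apply/suppP => w; rewrite coefD -scaleN1r coefZ cE mulN1r.
case: ifP => [_|/negbT ne]; first by rewrite subrr eqxx.
by rewrite subr0 lt_neqAle ne /=; apply: wbideg_le_bideg.
Qed.

Lemma Lt_sub a b p : Lt a p -> (a <= b)%O -> Lt b p.
Proof. by move=> Lp ab; apply: supp_sub Lp => s /lt_le_trans; apply. Qed.

Lemma Le_Lt a b p : Le a p -> (a < b)%O -> Lt b p.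
Proof. by move=> Lp ab; apply: supp_sub Lp => s /le_lt_trans; apply. Qed.

Lemma Hom_Le a p : Hom a p -> Le a p.
Proof. by apply: supp_sub => s /eqP ->. Qed.

Lemma Lt_Le a p : Lt a p -> Le a p.
Proof. by apply: supp_sub => s /ltW. Qed.

Lemma Le_bideg p : Le (fbideg p) p.
Proof. by apply/suppP => w /wbideg_le_bideg. Qed.

Lemma has_topD a u p r : has_top a u p -> Lt a r -> has_top a u (p + r).
Proof. by case=> Hu u0 Lp Lr; split=> //; rewrite addrAC; apply: suppD. Qed.

Lemma has_topZ a u p c : c != 0 -> has_top a u p -> has_top a (c *: u) (c *: p).
Proof.
move=> c0 [Hu u0 Lp]; split; rewrite ?suppZ ?scaler_eq0 ?negb_or ?c0 //.
by rewrite -scalerBr; apply: suppZ.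
Qed.

Lemma HomM a b p q : Hom a p -> Hom b q -> Hom (badd a b) (p * q).
Proof. by apply: suppM => s t /eqP <- /eqP <-; rewrite wbideg_cat. Qed.

Lemma LtLeM a b p q : Lt a p -> Le b q -> Lt (badd a b) (p * q).
Proof.
apply: suppM => s t; rewrite wbideg_cat !ltnbP leqbP /=; lia.
Qed.

Lemma LeLtM a b p q : Le a p -> Lt b q -> Lt (badd a b) (p * q).
Proof.
apply: suppM => s t; rewrite wbideg_cat !ltnbP leqbP /=; lia.
Qed.

Lemma z_onlyE p : fz_only p = ((fbideg p).1 == 0%N).
Proof.
have xy0 s : all (pred1 lz) s = ((wbideg s).1 == 0%N).
  by rewrite /wbideg /xypart size_filter -leqn0 leqNgt -has_count -all_predC; apply: eq_all => i /=; rewrite negbK.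
apply/idP/eqP => [zp|b0].
  have [->|p0] := eqVneq p 0.
    have := bideg_le (supp0 F _ : Le (0%N, 0%N) 0); rewrite leqbP /=; lia.
  have [w [w0 <-]] := bideg_attained p0.
  by apply/eqP; rewrite -xy0; apply: (suppP _ _ zp).
apply/suppP => w /wbideg_le_bideg; rewrite xy0 leqbP b0; lia.
Qed.

Lemma z_only_Lt a p : (0 < a.1)%N -> fz_only p -> Lt a p.
Proof.
by move=> a0; rewrite z_onlyE => p0; apply: (Le_Lt (Le_bideg p)); rewrite ltnbP; lia.
Qed.

Lemma suppI P Q p : supp P p -> supp Q p -> supp (predI P Q) p.
Proof. by move=> /suppP Pp /suppP Qp; apply/suppP => w w0 /=; rewrite Pp ?Qp. Qed.

(* The bidegree of q(g, z), for q of bidegree [a] in (y, z) and g of bidegree [b]. *)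
Definition bsubst (b a : bdeg) : bdeg := (a.1 * b.1, a.1 * b.2 + a.2)%N.

Lemma bsubst_lt a a' b : (0 < b.1)%N -> (a < a')%O -> (bsubst b a < bsubst b a')%O.
Proof. rewrite !ltnbP /=; nia. Qed.

Lemma bsubst_word i s b : i != lx ->
  bsubst b (wbideg (i :: s)) = badd (if i == lz then (0, 1)%N else b) (bsubst b (wbideg s)).
Proof.
rewrite /bsubst /badd /wbideg /xypart /=.
by elim/letterP: i => //= _; congr pair; lia.
Qed.

Lemma substy_word_top b v g s : Hom b v -> Lt b (g - v) -> all (predC1 lx) s ->
  Hom (bsubst b (wbideg s)) (fsubsty (fword F s) v) /\
  Lt (bsubst b (wbideg s)) (fsubsty (fword F s) g - fsubsty (fword F s) v).
Proof.
move=> Hv Lg; elim: s => [|i s IH] /=.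
  by rewrite /fsubsty word_nil !zend1 subrr supp0 -word_nil supp_word.
case/andP=> ix /IH {IH} [Hs Ls]; rewrite bsubst_word //.
rewrite -cat1s /fsubsty !word_cat !zendM -!/(fsubsty _ _).
set G := fsubsty _ g in Ls *; set V := fsubsty _ v in Hs Ls *.
rewrite ![fsubsty (fword F [:: i]) _]zend_word !big_seq1 /letter_image.
move: ix; elim/letterP: i => //= _.
  split; first exact: HomM.
  rewrite (_ : _ - _ = (g - v) * G + v * (G - V)).
    apply: suppD.
      apply: LtLeM => //; rewrite -[G](subrK V).
      by apply: suppD; [exact: Lt_Le | exact: Hom_Le].
    by apply: LeLtM => //; apply: Hom_Le.
  by rewrite mulrBl mulrBr addrA subrK.
have HZ : Hom (0, 1)%N fZ by rewrite supp_word.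
split; first exact: HomM.
by rewrite -mulrBr; apply: LeLtM => //; apply: Hom_Le.
Qed.

Lemma substy_Hom a b q v : fyz_only q -> Hom a q -> Hom b v ->
  Hom (bsubst b a) (fsubsty q v).
Proof.
move=> yq Hq Hv; have Q := suppI yq Hq; elim/supp_ind: Q => [|p1 p2 H1 H2|c p1 H1|s /=].
- by rewrite /fsubsty zend0 supp0.
- by rewrite /fsubsty zendD suppD.
- by rewrite /fsubsty zend_scale suppZ.
case/andP=> ys /eqP <-.
by case: (@substy_word_top b v v s) => //; rewrite subrr supp0.
Qed.

Lemma substy_Lt a b q v g : (0 < b.1)%N -> fyz_only q -> Lt a q -> Hom b v -> Lt b (g - v) ->
  Lt (bsubst b a) (fsubsty q g).
Proof.
move=> b0 yq Hq Hv Lg; have Q := suppI yq Hq; elim/supp_ind: Q => [|p1 p2 H1 H2|c p1 H1|s /=].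
- by rewrite /fsubsty zend0 supp0.
- by rewrite /fsubsty zendD suppD.
- by rewrite /fsubsty zend_scale suppZ.
case/andP=> ys sa; have lt_b := bsubst_lt b0 sa.
have [Hs Ls] := substy_word_top Hv Lg ys.
rewrite -[X in Lt _ X](subrK (fsubsty (fword F s) v)) suppD //.
  exact/(Lt_sub Ls)/ltW.
exact: (Le_Lt (Hom_Le Hs)).
Qed.

Lemma substy_LtB a b q v g : fyz_only q -> Hom a q -> Hom b v -> Lt b (g - v) ->
  Lt (bsubst b a) (fsubsty q g - fsubsty q v).
Proof.
move=> yq Hq Hv Lg; have Q := suppI yq Hq; elim/supp_ind: Q => [|p1 p2 H1 H2|c p1 H1|s /=].
- by rewrite /fsubsty !zend0 subrr supp0.
- by rewrite /fsubsty !zendD opprD addrACA suppD.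
- by rewrite /fsubsty !zend_scale -scalerBr suppZ.
case/andP=> ys /eqP <-; by case: (substy_word_top Hv Lg ys).
Qed.

Lemma substy_top a b q r g v : (0 < b.1)%N -> fyz_only q -> fyz_only r ->
  has_top a r q -> has_top b v g -> fsubsty r v != 0 ->
  has_top (bsubst b a) (fsubsty r v) (fsubsty q g).
Proof.
move=> b0 yq yt [Ht r0 Lq] [Hv v0 Lg] rv0; split=> //; first exact: substy_Hom.
rewrite -[q](subrK r) /fsubsty zendD -!/(fsubsty _ _) -addrA.
apply: suppD; last exact: substy_LtB.
by apply: substy_Lt Lg => //; apply: suppB.
Qed.

End Bidegree.

(** * Words and their z-gaps *)

Local Open Scope nat_scope.

Lemma zgaps_cons s : zgaps s = head 0 (zgaps s) :: behead (zgaps s).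
Proof. by case: s => //= i s; case: ifP. Qed.

Lemma weaveE a us : weave a us = nseq (a 0) lz ++
  (if us is u :: us' then u :: weave (fun i => a i.+1) us' else [::]).
Proof. by case: us. Qed.

Lemma weave_ext a b us : (forall i, i <= size us -> a i = b i) -> weave a us = weave b us.
Proof.
elim: us a b => [|u us IH] a b ab; rewrite (weaveE a) (weaveE b) ab //.
by rewrite (IH _ (fun i => b i.+1)) // => i; apply: (ab i.+1).
Qed.

Lemma weaveK s : weave (nth 0 (zgaps s)) (xypart s) = s.
Proof.
elim: s => //= i s IH; case: (i =P lz) => [->|_] /=; last by congr cons; apply: IH.
rewrite -[in RHS]IH [LHS]weaveE [in RHS]weaveE /= nth0; congr (_ :: _ ++ _).
by case: (xypart s) => // u us; congr cons; apply: weave_ext => j _; rewrite nth_behead.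
Qed.

Lemma xypart_weave a us : all (predC1 lz) us -> xypart (weave a us) = us.
Proof.
have xyz n : xypart (nseq n lz) = [::] by elim: n.
elim: us a => [|u us IH] a; rewrite weaveE /xypart filter_cat -!/(xypart _) xyz //=.
by case/andP=> -> /IH ->.
Qed.

Lemma xypart_cat s t : xypart (s ++ t) = xypart s ++ xypart t.
Proof. exact: filter_cat. Qed.

Lemma xypart_yz s : all (predC1 lx) s -> xypart s = nseq (size (xypart s)) ly.
Proof.
move=> ys; apply/all_pred1P/allP => i; rewrite mem_filter => /andP[iz /(allP ys)].
by move: iz; elim/letterP: i.
Qed.

Local Open Scope ring_scope.

Section MpolyLinear.
Variables (K : fieldType) (n : nat).
Implicit Types (V : lmodType K) (p s t : {mpoly K[n]}).

Definition mlin V (G : 'X_{1..n} -> V) p : V := \sum_(m <- msupp p) p@_m *: G m.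

Lemma mlinEw V (G : 'X_{1..n} -> V) d p :
  uniq d -> {subset msupp p <= d} -> mlin G p = \sum_(m <- d) p@_m *: G m.
Proof.
move=> Ud sub_d; rewrite [RHS](bigID (fun m => p@_m != 0)) /= [X in _ + X]big1 => [|m].
  rewrite addr0 -big_filter; apply/perm_big/uniq_perm; rewrite ?msupp_uniq ?filter_uniq //.
  move=> m; rewrite mem_filter -mcoeff_msupp.
  by case: (boolP (m \in _)) => //= /sub_d ->.
by rewrite negbK => /eqP->; rewrite scale0r.
Qed.

Lemma mlin_is_linear V (G : 'X_{1..n} -> V) : linear (mlin G).
Proof.
move=> c p q; pose d := undup (msupp (c *: p + q) ++ msupp p ++ msupp q).
have Ud : uniq d := undup_uniq _.
rewrite !(@mlinEw _ _ d) //.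
- rewrite scaler_sumr -big_split /=; apply: eq_bigr => w _.
  by rewrite mcoeffD mcoeffZ scalerDl scalerA.
- by move=> w; rewrite mem_undup !mem_cat => ->; rewrite !orbT.
- by move=> w; rewrite mem_undup !mem_cat => ->; rewrite !orbT.
- by move=> w; rewrite mem_undup !mem_cat => ->.
Qed.

HB.instance Definition _ V (G : 'X_{1..n} -> V) :=
  GRing.isLinear.Build K {mpoly K[n]} V *:%R (mlin G) (mlin_is_linear G).

Lemma mlinX V (G : 'X_{1..n} -> V) m : mlin G 'X_[m] = G m.
Proof. by rewrite /mlin msuppX big_seq1 mcoeffX eqxx scale1r. Qed.

Lemma mdiv_loopE fuel s t acc : s != 0 -> (size (msupp t) <= fuel)%N ->
  mdiv_loop fuel (t * s) s acc = acc + t.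
Proof.
move=> s0; elim: fuel t acc => [|fuel IH] t acc /=.
  by rewrite leqn0 => /nilP /eqP; rewrite msupp_eq0 => /eqP ->; rewrite addr0.
have [->|t0] := eqVneq t 0; first by rewrite mul0r eqxx addr0.
rewrite mulf_neq0 //= mleadM // lem_addl => szt.
rewrite mleadcM mulfK ?mleadc_eq0 // addmK.
set lt := mleadc t *: _.
rewrite -mulrBl IH; first by rewrite -addrA [lt + _]addrC subrK.
have st : mlead t \in msupp t by rewrite mlead_supp.
rewrite (perm_size (msupp_rem _ _)) size_rem //.
by move: szt; case: (size _).
Qed.

Lemma mdivK s t : s != 0 -> mdiv (t * s) s = t.
Proof.
move=> s0; rewrite /mdiv mdiv_loopE ?add0r //.
have [->|t0] := eqVneq t 0; first by rewrite msupp0.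
rewrite cardE -(size_map (@bmnm n (msize (t * s)))).
apply: uniq_leq_size; first exact: msupp_uniq.
move=> m mt; have lt_m : (mdeg m < msize (t * s))%N.
  rewrite msizeM //; have := msize_mdeg_lt mt.
  have : (0 < msize s)%N by rewrite lt0n msize_poly_eq0.
  by case: (msize s) => // k _; rewrite addnS; apply: ltn_addr.
by apply/mapP; exists (BMultinom lt_m); rewrite ?mem_enum.
Qed.
End MpolyLinear.

(* The monomial of a word s, whose z's at the i-th gap give t_{j + i k}. *)
Fixpoint gapm (k l j : nat) (s : seq letter) : 'X_{1..l.+1} :=
  if s is i :: s' then
    if i == lz then (U_(inord j) + gapm k l j s')%MM else gapm k l (j + k) s'
  else 0%MM.

Lemma gapm_nth k l s j i : (0 < k)%N -> ((j + size (xypart s)) * k <= l)%N ->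
  (i * k <= l)%N ->
  gapm k l (j * k) s (inord (i * k)) =
    if (j <= i)%N then nth 0%N (zgaps s) (i - j) else 0%N.
Proof.
move=> k0; elim: s j => [|a s IH] j /= le_j le_i.
  by rewrite mnm0E; case: ifP => // _; case: (i - j)%N => [|[]].
case: eqP le_j => [->|_] /= le_j; last first.
  rewrite addnC -mulSn IH ?addSnnS //.
  case: (ltngtP j i) => // ji; last by rewrite ji subnn.
  by rewrite -(subnSK ji).
rewrite mnmDE mnm1E IH // -val_eqE /= !inordK ?ltnS //; last first.
  by apply: leq_trans le_j; rewrite leq_mul2r leq_addr orbT.
rewrite eqn_mul2r (gtn_eqF k0) /=; case: (ltngtP j i) => // ji.
  by rewrite -(subnSK ji) /= [zgaps s in LHS]zgaps_cons.
by rewrite ji subnn /= [zgaps s in LHS]zgaps_cons.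
Qed.

Lemma gapm_cat k l j s t :
  gapm k l j (s ++ t) = (gapm k l j s + gapm k l (j + size (xypart s) * k) t)%MM.
Proof.
elim: s j => [|a s IH] j /=; first by rewrite mul0n addn0 add0m.
case: eqP => [->|_] /=; first by rewrite IH addmA.
by rewrite IH mulSn addnA.
Qed.

(** * The product formula *)

Section ProductFormula.
Variables (K : fieldType) (F : free_model K).
Local Notation A := (fm_alg F).
Local Notation M := (fm_mon F).
Local Notation msup := (@fm_supp K F).
Local Notation "p @[ w ]" := (fm_coef w p) (at level 2, format "p @[ w ]").
Local Notation mseq := (@fm_seq K F).
Local Notation word := (fword F).
Implicit Types (p q r f g h u v : A) (c : K) (fg : A * A) (s t us : seq letter).
Implicit Types (P Q : pred (seq letter)) (w : M).

Definition fxyhomog n := @supp K F (fun s => size (xypart s) == n).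

Definition ftact n (p : {mpoly K[n.+1]}) h : A :=
  \sum_(m <- msupp p) \sum_(w <- msup h)
    (p@_m * h@[w]) *:
      word (weave (fun i => nth 0 (zgaps (mseq w)) i + m (inord i))%N (xypart (mseq w))).

Definition ftcoef n us h : {mpoly K[n.+1]} :=
  \sum_(w <- msup h | xypart (mseq w) == us)
    h@[w] *: 'X_[ [multinom nth 0%N (zgaps (mseq w)) i | i < n.+1] ].

(* The coefficient of h at the basis element [us], in t_j, t_{j+1}, etc. *)
Definition xycoef l j us : A -> {mpoly K[l.+1]} :=
  wlin (fun s => if xypart s == us then 'X_[gapm 1 l j s] else 0).

Definition zweight k l j : A -> {mpoly K[l.+1]} := wlin (fun s => 'X_[gapm k l j s]).

Lemma gapm_multinom n s : (size (xypart s) <= n)%N ->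
  [multinom nth 0%N (zgaps s) i | i < n.+1] = gapm 1 n 0 s.
Proof.
move=> sn; apply/mnmP => i; rewrite mnmE.
have := @gapm_nth 1 n s 0 i isT; rewrite mul0n !muln1 inord_val subn0 add0n => ->//.
by rewrite -ltnS.
Qed.

Lemma tcoefE n us h : (size us <= n)%N -> ftcoef n us h = xycoef n 0 us h.
Proof.
move=> sn; rewrite /ftcoef big_mkcond; apply: eq_bigr => w _.
by case: eqP => [E|_]; rewrite ?scaler0 // gapm_multinom // E.
Qed.

Lemma gapm_shift k l j j0 s : (j + size (xypart s) <= k)%N ->
  ('X_[gapm 1 k j s] : {mpoly K[_]}) \mPo [tuple 'X_(inord (j0 + i)) | i < k.+1]
    = 'X_[gapm 1 l (j0 + j) s].
Proof.
elim: s j => [|a s IH] j /=; first by rewrite !mpolyX0 comp_mpoly1.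
case: eqP => [->|_] /= le_k; last by rewrite IH ?addnA //; lia.
rewrite !mpolyXD rmorphM /= IH // comp_mpolyXU; congr (_ * _).
rewrite -tnth_nth tnth_mktuple inordK // ltnS; lia.
Qed.

Lemma tcoef_shift k l j us h : size us = k ->
  ftcoef k us h \mPo [tuple 'X_(inord (j + i)) | i < k.+1] = xycoef l j us h.
Proof.
move=> sk; rewrite tcoefE ?sk // /xycoef /wlin linear_sum; apply: eq_bigr => w _.
rewrite linearZ /=; case: eqP => [E|_]; last by rewrite comp_mpoly0.
by rewrite (gapm_shift l) ?E ?sk // addn0.
Qed.

Lemma xycoefM l j us1 us2 p q : fxyhomog (size us1) p ->
  xycoef l j (us1 ++ us2) (p * q) = xycoef l j us1 p * xycoef l (j + size us1) us2 q.
Proof.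
move=> Hp; have Q := supp_predT q.
elim/supp_ind: Hp => [|p1 p2 H1 H2|c p1 H1|s /eqP Ps].
- by rewrite mul0r /xycoef !linear0 mul0r.
- by rewrite mulrDl /xycoef !linearD mulrDl; congr (_ + _).
- by rewrite -scalerAl /xycoef !linearZ /= -scalerAl; congr (_ *: _).
elim/supp_ind: Q => [|q1 q2 H1 H2|c q1 H1|t _].
- by rewrite mulr0 /xycoef !linear0 mulr0.
- by rewrite mulrDr /xycoef !linearD mulrDr; congr (_ + _).
- by rewrite -scalerAr /xycoef !linearZ /= -scalerAr; congr (_ *: _).
rewrite -word_cat /xycoef !wlin_word xypart_cat eqseq_cat // gapm_cat Ps muln1.
by case: eqP => _ /=; rewrite ?mul0r //; case: eqP => _; rewrite ?mulr0 ?mpolyXD.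
Qed.

Lemma xycoef_inj l j v w : v@[w] != 0 -> (j + size (xypart (mseq w)) <= l)%N ->
  xycoef l j (xypart (mseq w)) v != 0.
Proof.
move=> w0 le_l.
suff E : (xycoef l j (xypart (mseq w)) v)@_(gapm 1 l j (mseq w)) = v@[w].
  by apply: contraNneq w0 => X0; rewrite -E X0 mcoeff0.
rewrite /xycoef /wlin linear_sum /= (bigD1_seq w) ?fm_supp_uniq ?fm_mem_supp //=.
rewrite eqxx mcoeffZ mcoeffX eqxx mulr1 big1 ?addr0 // => w' ne.
rewrite mcoeffZ; case: eqP => [E|_]; last by rewrite mcoeff0 mulr0.
rewrite mcoeffX; case: eqP => [E'|_]; last by rewrite mulr0.
case/eqP: ne; apply: (can_inj (@fm_seqK K F)).
rewrite -[RHS]weaveK -[LHS]weaveK E; apply: weave_ext => i le_i.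
have := @gapm_nth 1 l (mseq w) j (j + i) isT; have := @gapm_nth 1 l (mseq w') j (j + i) isT.
rewrite !muln1 E E' leq_addr addKn => -> //; first by move=> -> //; lia.
lia.
Qed.

Lemma substy_word_xycoef l k j us s v : fxyhomog k v -> all (predC1 lx) s ->
  size us = (size (xypart s) * k)%N ->
  xycoef l j us (fsubsty (word s) v) =
    'X_[gapm k l j s] *
    \prod_(i < size (xypart s)) xycoef l (j + i * k) (take k (drop (i * k) us)) v.
Proof.
move=> Hv; elim: s j us => [|a s IH] j us /=.
  move=> _ /size0nil ->; rewrite /fsubsty word_nil zend1 -word_nil /xycoef wlin_word.
  by rewrite eqxx big_ord0 mulr1 mpolyX0.
rewrite -[a :: s]cat1s word_cat /fsubsty zendM -!/(fsubsty _ _).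
rewrite [fsubsty (word [:: a]) _]zend_word big_seq1 /letter_image.
elim/letterP: a => //= ys us_s; last first.
  have HZ : fxyhomog (size ([::] : seq letter)) fZ by exact: supp_word.
  rewrite -[us]cat0s (xycoefM _ _ _ _ HZ) addn0 IH // cat0s.
  by rewrite {1}/xycoef wlin_word /= addm0 mpolyXD mulrA.
have s_us : size (take k us) = k by rewrite size_takel // us_s leq_addr.
rewrite -{1}[us](cat_take_drop k) xycoefM ?s_us //.
rewrite IH //; last by rewrite size_drop us_s mulSn addKn.
rewrite big_ord_recl mul0n addn0 drop0 mulrCA; congr (_ * (_ * _)).
by apply: eq_bigr => i _; rewrite drop_drop lift0 mulSn addnA [(i * k + k)%N]addnC.
Qed.

Lemma substy_xycoef l k d us q v : fxyhomog k v -> fyz_only q -> fxyhomog d q ->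
  size us = (d * k)%N ->
  xycoef l 0 us (fsubsty q v) =
    zweight k l 0 q * \prod_(i < d) xycoef l (i * k) (take k (drop (i * k) us)) v.
Proof.
move=> Hv yq Hq us_s; have Q := suppI yq Hq.
elim/supp_ind: Q => [|p1 p2 H1 H2|c p1 H1|s /andP[ys /eqP sd]].
- by rewrite /fsubsty zend0 /xycoef /zweight !linear0 mul0r.
- by rewrite /fsubsty zendD /xycoef /zweight !linearD mulrDl; congr (_ + _).
- by rewrite /fsubsty zend_scale /xycoef /zweight !linearZ /= -scalerAl; congr (_ *: _).
rewrite (substy_word_xycoef _ _ Hv ys) ?sd // /zweight wlin_word; congr (_ * _).
Qed.

Lemma contract_zweight l k d q : (0 < k)%N -> l = (d * k)%N -> fxyhomog d q ->
  contract k d (zweight k l 0 q) = zweight 1 d 0 q.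
Proof.
move=> k0 lE Hq.
pose G (m : 'X_{1..l.+1}) : {mpoly K[d.+1]} := 'X_[ [multinom m (inord (i * k)) | i < d.+1] ].
rewrite -[LHS]/(mlin G _) /zweight /wlin linear_sum; apply: eq_big_seq => w /(allP Hq) /eqP sd.
rewrite linearZ /=; congr (_ *: _); rewrite mlinX /G; congr 'X_[_].
rewrite -gapm_multinom ?sd //; apply/mnmP => i; rewrite !mnmE.
have := @gapm_nth k l (mseq w) 0 i k0; rewrite mul0n subn0 => ->//.
  by rewrite add0n sd lE.
by rewrite lE leq_mul2r -ltnS ltn_ord orbT.
Qed.

Lemma fYX d : fY ^+ d = word (nseq d ly) :> A.
Proof. by elim: d => [|d IH]; rewrite ?word_nil ?expr0 // exprS IH -word_cat. Qed.

Definition ytact d (m : 'X_{1..d.+1}) : A := word (weave (fun i => m (inord i)) (nseq d ly)).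

Lemma tactE d (p : {mpoly K[d.+1]}) : ftact p (fY ^+ d) = mlin (@ytact d) p.
Proof.
apply: eq_bigr => m _; rewrite fYX supp_fword big_seq1 coef_word fm_mkK eqxx mulr1.
have ys : all (predC1 lx) (nseq d ly) by rewrite all_nseq orbT.
have -> : xypart (nseq d ly) = nseq d ly.
  by apply/all_filterP; rewrite all_nseq orbT.
congr (_ *: word _); apply: weave_ext => i _; suff -> : nth 0%N (zgaps (nseq d ly)) i = 0%N by [].
by elim: d i {p m ys} => [|d IH] [|i] //=; rewrite ?nth_nil.
Qed.

Lemma tact_zweight d q : fyz_only q -> fxyhomog d q -> mlin (@ytact d) (zweight 1 d 0 q) = q.
Proof.
move=> yq Hq; rewrite /zweight /wlin linear_sum [RHS]fm_expand; apply: eq_big_seq => w wq.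
rewrite linearZ /=; congr (_ *: _); rewrite mlinX /ytact basis_word; congr word.
have ys := allP yq w wq; have /eqP sd := allP Hq w wq.
rewrite -[RHS]weaveK [in RHS]xypart_yz // sd; apply: weave_ext => i; rewrite size_nseq => le_i.
by rewrite -gapm_multinom ?sd // mnmE inordK.
Qed.

Lemma ytact_spec d (p : {mpoly K[d.+1]}) :
  fyz_only (mlin (@ytact d) p) && fxyhomog d (mlin (@ytact d) p).
Proof.
have S P : (forall m : 'X_{1..d.+1}, supp P (ytact m)) -> supp P (mlin (@ytact d) p).
  move=> H; rewrite /mlin; elim/big_ind: _ => [|x y|m _]; [exact: supp0|exact: suppD|].
  exact/suppZ/H.
apply/andP; split; apply: S => m; apply: supp_word; last first.
  by rewrite xypart_weave ?size_nseq // all_nseq orbT.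
rewrite /=; move: (fun i => m (inord i)) => a; elim: d a {p m} => [|d IH] a.
  by rewrite weaveE cats0 all_nseq orbT.
by rewrite weaveE all_cat all_nseq orbT /= IH.
Qed.

Lemma zweight_neq0 k l d q : (0 < k)%N -> l = (d * k)%N -> fyz_only q -> fxyhomog d q ->
  q != 0 -> zweight k l 0 q != 0.
Proof.
move=> k0 lE yq Hq; apply: contraNneq => W0.
rewrite -(tact_zweight yq Hq) -(contract_zweight k0 lE Hq) W0.
by rewrite /contract msupp0 big_nil linear0.
Qed.

Lemma substy_neq0 k d q v : (0 < k)%N -> fxyhomog k v -> v != 0 ->
  fyz_only q -> fxyhomog d q -> q != 0 -> fsubsty q v != 0.
Proof.
move=> k0 Hv v0 yq Hq q0; have [w [w0 /eqP sw]] := supp_neq0 Hv v0.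
set us0 := xypart (mseq w) in sw.
pose us := flatten (nseq d us0).
have us_s : size us = (d * k)%N.
  by rewrite /us; elim: (d) => //= n IH; rewrite size_cat IH sw mulSn.
have blk i : (i < d)%N -> take k (drop (i * k) us) = us0.
  rewrite /us; elim: (d) i => [|n IH] [|i] //= lt_i.
    by rewrite mul0n drop0 -sw take_size_cat.
  by rewrite mulSn drop_cat sw ltnNge leq_addr /= addKn IH.
have := substy_xycoef (d * k) Hv yq Hq us_s; apply: contra_eq_neq => ->.
rewrite /xycoef linear0 eq_sym mulf_neq0 ?(zweight_neq0 k0 _ yq Hq) //.
apply/prodf_neq0 => i _; rewrite blk // -/(xycoef _ _ _ _) xycoef_inj //.
rewrite -/us0 sw -mulSnr leq_mul2r ltn_ord orbT //.
Qed.

Lemma substy_scale d c q v : fyz_only q -> fxyhomog d q ->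
  fsubsty q (c *: v) = c ^+ d *: fsubsty q v.
Proof.
move=> yq Hq; have Q := suppI yq Hq.
elim/supp_ind: Q => [|p1 p2 H1 H2|b p1 H1|s /andP[ys /eqP sd]].
- by rewrite /fsubsty !zend0 scaler0.
- by rewrite /fsubsty !zendD scalerDr; congr (_ + _).
- by rewrite /fsubsty !zend_scale scalerA mulrC -scalerA; congr (_ *: _).
elim: s d ys sd {Hq} => [|a s IH] d /= => [_ <-|].
  by rewrite /fsubsty word_nil !zend1 expr0 scale1r.
rewrite -[a :: s]cat1s word_cat /fsubsty !zendM -!/(fsubsty _ _).
rewrite ![fsubsty (word [:: a]) _]zend_word !big_seq1 /letter_image.
elim/letterP: a => //= ys <-.
  by rewrite (IH (size (xypart s))) // exprS -scalerAl -!scalerAr scalerA.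
by rewrite (IH (size (xypart s))) // -!scalerAr.
Qed.

Definition fxydeg p : nat := (fbideg p).1.

Definition fpresents c q u v : Prop :=
  exists d : nat,
    [/\ (0 < d)%N, fxydeg u = (fxydeg v * d)%N, c != 0,
        fyz_only q && fxyhomog d q & u = fsubsty q (c^-1 *: v)].

Definition ffind_q c u v : option A :=
  let l := fxydeg u in
  let k := fxydeg v in
  let d := (l %/ k)%N in
  if ~~ ((k %| l)%N && (0 < d)%N) then None else
  let us := head [::] [seq xypart (mseq w) | w <- msup u] in
  let lambda : {mpoly K[l.+1]} := ftcoef l us u in
  let theta : {mpoly K[l.+1]} :=
    \prod_(s < d) (ftcoef k (take k (drop (s * k) us)) v
                    \mPo [tuple 'X_(inord (s * k + i)) | i < k.+1]) in
  let q := ftact (c ^+ d *: contract k d (mdiv lambda theta)) (fY ^+ d) in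
  if u == fsubsty q (c^-1 *: v) then Some q else None.

Lemma presents_rescale c c' q u v : c != 0 -> fpresents c' q u v ->
  exists q', fpresents c q' u v.
Proof.
move=> c0 [d [d0 lE c'0 /andP[yq Hq] uE]]; exists ((c / c') ^+ d *: q); exists d; split=> //.
  by apply/andP; split; apply: suppZ.
rewrite uE (substy_scale _ _ yq Hq) [in RHS]/fsubsty zend_scale -/(fsubsty _ _).
by rewrite (substy_scale _ _ yq Hq) scalerA -exprMn mulrAC divff // mul1r.
Qed.

Lemma find_q_presents c q u v : c != 0 -> ffind_q c u v = Some q -> fpresents c q u v.
Proof.
move=> c0; rewrite /ffind_q; case: ifP => // /negbFE /andP[kl d0].
case: ifP => // /eqP uE [qE]; rewrite qE in uE.
exists (fxydeg u %/ fxydeg v)%N; split=> //; first by rewrite mulnC divnK.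
by rewrite -qE tactE ytact_spec.
Qed.

Lemma presents_find_q c q u v : u != 0 -> fxyhomog (fxydeg u) u ->
  (0 < fxydeg v)%N -> fxyhomog (fxydeg v) v ->
  fpresents c q u v -> ffind_q c u v = Some q.
Proof.
move=> u0 Hu v0 Hv; case=> d [d0 lE c0 /andP[yq Hq] uE]; rewrite /ffind_q.
have -> : (fxydeg u %/ fxydeg v)%N = d by rewrite lE mulKn.
rewrite d0 andbT {1}lE dvdn_mulr //=.
set us := head _ _.
have [w [w0 usE]] : exists w, u@[w] != 0 /\ xypart (mseq w) = us.
  have [w [w0 _]] := supp_neq0 Hu u0; rewrite /us.
  move: w0; rewrite -fm_mem_supp; case E : (msup u) => [//|w' ?] _.
  by exists w'; rewrite -fm_mem_supp E mem_head.
have us_s : size us = fxydeg u by rewrite -usE; apply/eqP; apply: (suppP _ _ Hu).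
set k := fxydeg v in lE Hv v0 *; set l := fxydeg u in lE us_s Hu *.
have blk (i : 'I_d) : size (take k (drop (i * k) us)) = k.
  rewrite size_takel // size_drop us_s lE.
  by have := ltn_ord i; nia.
under [X in mdiv _ X]eq_bigr => i _ do rewrite (tcoef_shift l _ _ (blk i)).
set theta := \prod_(i < d) _.
have us_dk : size us = (d * k)%N by rewrite us_s lE mulnC.
have lambdaE : ftcoef l us u = c ^- d *: zweight k l 0 q * theta.
  rewrite tcoefE ?us_s // uE (substy_scale _ _ yq Hq) exprVn.
  by rewrite {1}/xycoef linearZ /= -/(xycoef _ _ _ _) (substy_xycoef l Hv yq Hq us_dk) -scalerAl.
have lambda0 : ftcoef l us u != 0.
  by rewrite tcoefE ?us_s // -usE xycoef_inj // usE us_s.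
have theta0 : theta != 0.
  by apply: contraNneq lambda0 => t0; rewrite lambdaE t0 mulr0.
have cd0 : c ^+ d != 0 by rewrite expf_neq0.
have -> : ftact (c ^+ d *: contract k d (mdiv (ftcoef l us u) theta)) (fY ^+ d) = q.
  rewrite lambdaE mdivK //.
  have -> : c ^- d *: zweight k l 0 q = zweight k l 0 (c ^- d *: q).
    by rewrite /zweight linearZ.
  rewrite (@contract_zweight _ _ d) // ?lE 1?mulnC //; last exact: suppZ.
  by rewrite /zweight linearZ /= scalerA divff // scale1r tactE tact_zweight.
by rewrite -uE eqxx.
Qed.

End ProductFormula.

(** * Normal form of tame automorphisms *)

Section TameGroup.
Variables (K : fieldType) (F : free_model K).
Local Notation A := (fm_alg F).
Local Notation word := (fword F).
Implicit Types (p q r f g h u v : A) (a b c d : K) (fg x y : A * A) (s t us : seq letter).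
Local Notation Le a := (@supp K F (fun s => (wbideg s <= a)%O)).
Local Notation id2 := (fX : A, fY : A).

Definition pcomp fg x : A * A := (fzend fg x.1, fzend fg x.2).

Lemma zend_pcomp fg x p : fzend (pcomp fg x) p = fzend fg (fzend x p).
Proof. by rewrite zend_comp. Qed.

Lemma pcompA fg x y : pcomp fg (pcomp x y) = pcomp (pcomp fg x) y.
Proof. by rewrite /pcomp /= !zend_comp. Qed.

Lemma pcomp1 fg : pcomp fg id2 = fg.
Proof. by rewrite /pcomp zendX zendY; case: fg. Qed.

Definition aff a b c d p r : A * A := (a *: fX + b *: fY + p, c *: fX + d *: fY + r).

Definition is_aff c fg := exists a b d p r,
  [/\ a * d - b * c != 0, fz_only p, fz_only r & fg = aff a b c d p r].

Lemma pcomp_aff f g a b c d p r : fz_only p -> fz_only r ->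
  pcomp (f, g) (aff a b c d p r) = (a *: f + b *: g + p, c *: f + d *: g + r).
Proof. by move=> zp zr; rewrite /pcomp !zendD !zend_scale zendX zendY !zend_z_only. Qed.

Lemma aff_pcomp a b c d p r a' b' c' d' p' r' : fz_only p' -> fz_only r' ->
  pcomp (aff a b c d p r) (aff a' b' c' d' p' r') =
  aff (a' * a + b' * c) (a' * b + b' * d) (c' * a + d' * c) (c' * b + d' * d)
    (a' *: p + b' *: r + p') (c' *: p + d' *: r + r').
Proof.
move=> zp zr; rewrite pcomp_aff // /aff !scalerDr !scalerDl !scalerA !addrA.
by congr (_, _); congr (_ + _); rewrite [LHS](ACl (1*4*2*5*3*6)) /=.
Qed.

Lemma z_only0 : fz_only (0 : A).
Proof. exact: supp0. Qed.

Lemma z_onlyN p : fz_only p -> fz_only (- p).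
Proof. exact: suppN. Qed.

Lemma is_aff_comp c c' x y : is_aff c x -> is_aff c' y ->
  exists2 c'', is_aff c'' (pcomp x y) & (c' = 0 -> (c'' == 0) = (c == 0)).
Proof.
move=> [a [b [d [p [r [D zp zr ->]]]]]] [a' [b' [d' [p' [r' [D' zp' zr' ->]]]]]].
exists (c' * a + d' * c); last first.
  move=> c0; move: D'; rewrite c0 mulr0 subr0 mul0r add0r mulf_eq0 negb_or mulf_eq0.
  by case/andP=> _ /negbTE ->.
rewrite aff_pcomp //; do 5!eexists; split; last reflexivity.
- rewrite (_ : _ - _ = (a * d - b * c) * (a' * d' - b' * c')) ?mulf_neq0 //; ring.
- by rewrite /fz_only !suppD ?suppZ.
- by rewrite /fz_only !suppD ?suppZ.
Qed.

Lemma aff_id a b c d p r : a = 1 -> b = 0 -> c = 0 -> d = 1 -> p = 0 -> r = 0 ->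
  aff a b c d p r = id2.
Proof. by move=> -> -> -> -> -> ->; rewrite /aff !scale1r !scale0r !addr0 add0r. Qed.

Lemma is_aff_id : is_aff 0 id2.
Proof.
exists 1, 0, 1, 0, 0; split; rewrite ?z_only0 ?aff_id //.
by rewrite mulr1 mulr0 subr0 oner_eq0.
Qed.

Definition pinv x y := pcomp x y = id2 /\ pcomp y x = id2.

Lemma pinv_comp x x' y y' : pinv x x' -> pinv y y' -> pinv (pcomp x y) (pcomp y' x').
Proof.
move=> [xx' x'x] [yy' y'y]; split; rewrite pcompA.
  by rewrite -(pcompA x) yy' pcomp1.
by rewrite -(pcompA y') x'x pcomp1.
Qed.

Lemma aff_trans_pinv p r : fz_only p -> fz_only r -> pinv (aff 1 0 0 1 p r) (aff 1 0 0 1 (- p) (- r)).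
Proof.
move=> zp zr; split; rewrite aff_pcomp ?z_onlyN //; apply: aff_id; try ring.
all: by rewrite scale1r scale0r ?addr0 ?add0r ?subrr ?addNr.
Qed.

Lemma aff_linear_pinv a b c d (e := a * d - b * c) : e != 0 ->
  pinv (aff a b c d 0 0) (aff (d / e) (- b / e) (- c / e) (a / e) 0 0).
Proof.
move=> e0; split; rewrite aff_pcomp ?z_only0 //; apply: aff_id; rewrite ?scaler0 ?addr0 //.
all: by rewrite /e; field.
Qed.

Lemma is_aff_inv c x : is_aff c x -> exists c' y, is_aff c' y /\ pinv x y.
Proof.
move=> [a [b [d [p [r [D zp zr ->]]]]]]; set e := a * d - b * c in D.
have z0 := z_only0.
have -> : aff a b c d p r = pcomp (aff a b c d 0 0) (aff 1 0 0 1 p r).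
  by rewrite aff_pcomp // !scaler0 !mul1r !mul0r !addr0 !add0r.
have [c' affT _] : exists2 c', is_aff c' (pcomp (aff 1 0 0 1 (- p) (- r))
    (aff (d / e) (- b / e) (- c / e) (a / e) 0 0)) & True.
  have A1 : is_aff 0 (aff 1 0 0 1 (- p) (- r)).
    by exists 1, 0, 1, (- p), (- r); split; rewrite ?z_onlyN // mulr1 mulr0 subr0 oner_eq0.
  have A2 : is_aff (- c / e) (aff (d / e) (- b / e) (- c / e) (a / e) 0 0).
    exists (d / e), (- b / e), (a / e), 0, 0; split=> //.
    rewrite (_ : _ - _ = e^-1) ?invr_neq0 //.
    by rewrite (_ : _ - _ = e / e / e) ?divff ?mul1r // /e; field.
  by have [c' A3 _] := is_aff_comp A1 A2; exists c'.
exists c'; eexists; split; first exact: affT.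
by apply: pinv_comp; [exact: aff_linear_pinv | exact: aff_trans_pinv].
Qed.

Definition el q : A * A := (fX + q, fY).

Lemma pcomp_el f g q : fyz_only q -> pcomp (f, g) (el q) = (f + fsubsty q g, g).
Proof. by move=> yq; rewrite /pcomp zendD zendX zendY zend_yz_only. Qed.

Lemma el_comp q r : fyz_only q -> fyz_only r -> pcomp (el q) (el r) = el (q + r).
Proof. by move=> yq yr; rewrite pcomp_el // -addrA /fsubsty zend_id. Qed.

Lemma el0 : el 0 = id2.
Proof. by rewrite /el addr0. Qed.

Lemma el_pinv q : fyz_only q -> pinv (el q) (el (- q)).
Proof.
move=> yq; have yN : fyz_only (- q) by apply: suppN.
by split; rewrite el_comp // ?subrr ?addNr el0.
Qed.

Lemma linear_form p : Le (1%N, 0%N) p -> exists a b r, fz_only r /\ p = a *: fX + b *: fY + r.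
Proof.
elim/supp_ind => [|p1 p2 [a [b [r [zr ->]]]] [a' [b' [r' [zr' ->]]]]|c p1 [a [b [r [zr ->]]]]|s].
- by exists 0, 0, 0; rewrite !scale0r !addr0; split=> //; apply: supp0.
- exists (a + a'), (b + b'), (r + r'); split; first exact: suppD.
  by rewrite !scalerDl [LHS](AC (3*3) (1*4*(2*5)*(3*6))).
- exists (c * a), (c * b), (c *: r); split; first exact: suppZ.
  by rewrite !scalerDr !scalerA.
rewrite leqbP /wbideg /=; case sx: (size (xypart s)) => [|[|n]] //=.
  exists 0, 0, (word s); rewrite !scale0r !add0r; split=> //; apply: supp_word.
  move/eqP: sx; rewrite size_filter -leqn0 leqNgt -has_count -all_predC.
  by apply: sub_all => i /=; rewrite negbK.
rewrite leqn0 => /eqP cz.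
have : count_mem lz s = 0%N -> s = xypart s.
  move/eqP; rewrite -leqn0 leqNgt -has_count => /hasPn zs; apply/esym/all_filterP/allP => i /zs //.
move=> /(_ cz) ->; case: (xypart s) sx (filter_all (predC1 lz) s : all _ (xypart s)) => [|i [|]] // _ /=.
rewrite andbT; elim/letterP: i => //= _.
  by exists 1, 0, 0; rewrite scale1r scale0r !addr0; split=> //; apply: supp0.
by exists 0, 1, 0; rewrite scale1r scale0r addr0 add0r; split=> //; apply: supp0.
Qed.

Lemma el_low q : fyz_only q -> (fbideg q <= (1%N, 0%N))%O -> is_aff 0 (el q).
Proof.
move=> yq le_q.
have [a [b [r [zr qE]]]] : exists a b r, fz_only r /\ q = a *: fX + b *: fY + r.
  by apply: linear_form; apply: supp_sub (Le_bideg q) => s /le_trans; apply.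
have := zend_yz_only (fX : A) fY yq; have := @zend_yz_only _ _ 0 fY _ yq.
move=> <-; rewrite zend_id => E.
exists 1, b, 1, r, 0; split; rewrite ?z_only0 //.
  by rewrite mulr1 mulr0 subr0 oner_eq0.
have -> : q = b *: fY + r.
  by rewrite [LHS]E [in LHS]qE !zendD !zend_scale zendX zendY zend_z_only // scaler0 add0r.
by rewrite /el /aff !scale1r scale0r add0r addr0 addrA.
Qed.

Lemma el_aff0 q y : fyz_only q -> is_aff 0 y ->
  exists2 q', fyz_only q' & pcomp (el q) y = pcomp y (el q').
Proof.
move=> yq [a [b [d [p [r [D zp zr ->]]]]]].
have d0 : d != 0 by apply: contraNneq D => ->; rewrite !mulr0 subr0.
have yr := z_only_yz_only zr.
exists (a *: fsubsty q (d^-1 *: (fY - r))).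
  by apply/suppZ/substy_yz_only => //; apply/suppZ/suppB => //; apply: supp_word.
rewrite [RHS]pcomp_el; last first.
  by apply/suppZ/substy_yz_only => //; apply/suppZ/suppB => //; apply: supp_word.
rewrite pcomp_aff // /fsubsty !zend_scale zend_comp /= zendX zend_scale zendB zendY (zend_z_only _ zr).
rewrite !scale0r !add0r addrK scalerA mulVf // scale1r.
rewrite zend_id /aff /=.
by rewrite scalerDr [in LHS](ACl (1*3*4*2)).
Qed.

(* Pairs (F, G) with G dominating F: multiplying by [el q] with q of bidegree *)
(* > (1, 0) makes the first entry dominate, and an affine map that involves   *)
(* the first entry in the second one restores the dominance of the latter.    *)
Inductive reduced : A * A -> Prop :=
| reduced_aff c x : is_aff c x -> reduced x
| reduced_next x q c y : reduced x -> fyz_only q -> (((1%N, 0%N) : bdeg) < fbideg q)%O ->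
    is_aff c y -> c != 0 -> reduced (pcomp (pcomp x (el q)) y).

Definition normal fg := exists x q, [/\ reduced x, fyz_only q & fg = pcomp x (el q)].

Lemma reduced_low x y : reduced x -> is_aff 0 y -> reduced (pcomp x y).
Proof.
case=> [c {}x ax|{}x q c z Rx yq bq az c0] ay.
  by have [c' axy _] := is_aff_comp ax ay; apply: reduced_aff axy.
have [c' azy c'E] := is_aff_comp az ay.
by rewrite -pcompA; apply: reduced_next azy _; rewrite // c'E.
Qed.

Lemma yz_only0 : fyz_only (0 : A).
Proof. exact: supp0. Qed.

Lemma reduced_normal x : reduced x -> normal x.
Proof. by move=> Rx; exists x, 0; rewrite el0 pcomp1 yz_only0. Qed.

Lemma normal_el x q : normal x -> fyz_only q -> normal (pcomp x (el q)).
Proof.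
move=> [y [r [Ry yr ->]]] yq; exists y, (r + q); split=> //; first exact: suppD.
by rewrite -pcompA el_comp.
Qed.

Lemma normal_low x y : normal x -> is_aff 0 y -> normal (pcomp x y).
Proof.
move=> [z [q [Rz yq ->]]] ay; have [q' yq' E] := el_aff0 yq ay.
by exists (pcomp z y), q'; split=> //; [exact: reduced_low | rewrite -!pcompA E].
Qed.

Lemma normal_aff c x y : normal x -> is_aff c y -> normal (pcomp x y).
Proof.
have low c' z : is_aff c' z -> c' == 0 -> is_aff 0 z by move=> az /eqP <-.
move=> Nx ay; case: (boolP (c == 0)) => [/(low _ _ ay)|c0]; first exact: normal_low.
case: Nx => z [q [Rz yq ->]].
have [bq|bq] := ltP ((1%N, 0%N) : bdeg) (fbideg q).
  by apply: reduced_normal; apply: reduced_next ay c0.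
have [c1 a1 _] := is_aff_comp (el_low yq bq) ay; rewrite -pcompA.
move: (pcomp _ _) a1 => {bq yq q y ay c0} y ay.
case: Rz => [c2 {}z az|{}z q c2 w Rz yq bq aw c0].
  by have [c3 a3 _] := is_aff_comp az ay; apply/reduced_normal/reduced_aff/a3.
have [c3 a3 _] := is_aff_comp aw ay; rewrite -pcompA.
case: (boolP (c3 == 0)) => [/(low _ _ a3)|c30]; last first.
  by apply: reduced_normal; apply: reduced_next a3 c30.
by apply: normal_low; exists z, q.
Qed.

Definition preserving (phi : A -> A) :=
  forall x, normal x -> exists2 y, normal y & fzend x \o phi =1 fzend y.

Definition good_auto (phi : A -> A) := exists psi, [/\ cancel phi psi, cancel psi phi,
  preserving phi & preserving psi].

Lemma pinv_cancel x y : pinv x y -> cancel (fzend x) (fzend y).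
Proof. by move=> [_ yx] p; rewrite -zend_pcomp yx zend_id. Qed.

Lemma pinv_sym x y : pinv x y -> pinv y x.
Proof. by case. Qed.

Lemma good_el q : fyz_only q -> good_auto (fzend (el q)).
Proof.
move=> yq; have yN : fyz_only (- q) by apply: suppN.
have E := el_pinv yq; exists (fzend (el (- q))); split; try exact: pinv_cancel.
- exact/pinv_cancel/pinv_sym.
- by move=> x Nx; exists (pcomp x (el q)); [exact: normal_el | move=> p /=; rewrite zend_pcomp].
- by move=> x Nx; exists (pcomp x (el (- q))); [exact: normal_el | move=> p /=; rewrite zend_pcomp].
Qed.

Lemma good_aff c y : is_aff c y -> good_auto (fzend y).
Proof.
move=> ay; have [c' [z [az E]]] := is_aff_inv ay.
exists (fzend z); split; try exact: pinv_cancel.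
- exact/pinv_cancel/pinv_sym.
- by move=> x Nx; exists (pcomp x y); [exact: normal_aff ay | move=> p /=; rewrite zend_pcomp].
- by move=> x Nx; exists (pcomp x z); [exact: normal_aff az | move=> p /=; rewrite zend_pcomp].
Qed.

Lemma preserving_comp phi psi : preserving phi -> preserving psi -> preserving (phi \o psi).
Proof.
move=> Hphi Hpsi x /Hphi[y /Hpsi[z Nz E] E']; exists z => // p /=.
by have /= := E' (psi p) => ->; apply: E.
Qed.

Lemma good_comp phi psi : good_auto phi -> good_auto psi -> good_auto (phi \o psi).
Proof.
move=> [phi' [c1 c2 p1 p2]] [psi' [c3 c4 p3 p4]]; exists (psi' \o phi').
split; [exact: can_comp | exact: can_comp | exact: preserving_comp | exact: preserving_comp].
Qed.

Lemma preserving_ext phi psi : phi =1 psi -> preserving phi -> preserving psi.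
Proof. by move=> E H x /H[y Ny Ey]; exists y => // p; rewrite -Ey /= E. Qed.

Lemma good_ext phi psi : phi =1 psi -> good_auto phi -> good_auto psi.
Proof.
move=> E [phi' [c1 c2 p1 p2]]; exists phi'; split=> //.
- by move=> p; rewrite -E c1.
- by move=> p; rewrite -E c2.
- exact: preserving_ext p1.
Qed.

Lemma good_inv phi psi : good_auto phi -> cancel phi psi -> cancel psi phi -> good_auto psi.
Proof.
move=> [phi' [c1 c2 p1 p2]] d1 d2.
have E : phi' =1 psi by move=> p; rewrite -[in LHS](d2 p) c1.
exists phi; split=> //; exact: preserving_ext p2.
Qed.

Definition flinear (a : 'M[K]_2) : A * A :=
  (a 0 0 *: fX + a 1 0 *: fY, a 0 1 *: fX + a 1 1 *: fY).

Definition faffine fg : Prop :=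
  exists (a : 'M[K]_2) (c b : 'rV[K]_2),
    a \in unitmx /\
    fg = ((flinear a).1 + c 0 0 *: fZ + (b 0 0)%:A,
          (flinear a).2 + c 0 1 *: fZ + (b 0 1)%:A).

Definition ftriangular fg : Prop :=
  exists (a1 a2 : K) (p1 p2 : A),
    [/\ a1 != 0, a2 != 0, fyz_only p1, fz_only p2 &
        fg = (a1 *: fX + p1, a2 *: fY + p2)].

Inductive ftame : (A -> A) -> Prop :=
| ftame_affine fg : faffine fg -> ftame (fzend fg)
| ftame_triangular fg : ftriangular fg -> ftame (fzend fg)
| ftame_id : ftame id
| ftame_comp phi psi : ftame phi -> ftame psi -> ftame (phi \o psi)
| ftame_inv phi psi :
    ftame phi -> cancel phi psi -> cancel psi phi -> ftame psi
| ftame_ext phi psi : phi =1 psi -> ftame phi -> ftame psi.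

Lemma unitmx2 (a : 'M[K]_2) : (a \in unitmx) = (a 0 0 * a 1 1 - a 1 0 * a 0 1 != 0).
Proof. rewrite unitmxE unitfE (expand_det_row _ 0) !big_ord_recl big_ord0 /cofactor !det_mx11 !mxE /=.
rewrite !expr0 expr1 mul1r mulN1r addr0 mulrN [a 1 0 * _]mulrC.
by congr (_ * a _ _ - a _ _ * a _ _ != 0); apply: val_inj. Qed.

Lemma faffine_aff fg : faffine fg -> exists c, is_aff c fg.
Proof.
move=> [a [c [b [ua ->]]]]; exists (a 0 1), (a 0 0), (a 1 0), (a 1 1).
exists (c 0 0 *: fZ + (b 0 0)%:A), (c 0 1 *: fZ + (b 0 1)%:A).
have zc (k l : K) : fz_only (k *: fZ + l%:A : A).
  by apply: suppD; apply: suppZ; rewrite -?word_nil; apply: supp_word.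
by split; rewrite ?zc -?unitmx2 // /aff /flinear !addrA.
Qed.

Lemma triangularE a1 a2 p1 p2 : a1 != 0 -> fyz_only p1 -> fz_only p2 ->
  (a1 *: fX + p1, a2 *: fY + p2) = pcomp (el (a1^-1 *: p1)) (aff a1 0 0 a2 0 p2).
Proof.
move=> a10 yp zp; rewrite pcomp_aff ?z_only0 // !scale0r !addr0 add0r.
by rewrite scalerDr scalerA mulfV // scale1r.
Qed.

Lemma diag_aff a1 a2 p : a1 != 0 -> a2 != 0 -> fz_only p -> is_aff 0 (aff a1 0 0 a2 0 p).
Proof.
move=> a10 a20 zp; exists a1, 0, a2, 0, p; split; rewrite ?z_only0 //.
by rewrite mul0r subr0 mulf_neq0.
Qed.

Lemma tame_good phi : ftame phi -> good_auto phi.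
Proof.
elim=> {phi} [fg /faffine_aff[c] |fg [a1 [a2 [p1 [p2 [a10 a20 yp zp ->]]]]]||
  phi psi _ Hphi _ Hpsi|phi psi _ Hphi c1 c2|phi psi E _ Hphi].
- exact: good_aff.
- have G := good_comp (good_el (suppZ a1^-1 yp : fyz_only _)) (good_aff (diag_aff a10 a20 zp)).
  by apply: good_ext G => p /=; rewrite triangularE // zend_pcomp.
- apply: good_ext (good_el yz_only0) => p; by rewrite el0 zend_id.
- exact: good_comp.
- exact: good_inv c1 c2.
- exact: good_ext Hphi.
Qed.

Lemma tame_bij phi : ftame phi -> bijective phi.
Proof. by move=> /tame_good[psi [c1 c2 _ _]]; exists psi. Qed.

Lemma tame_normal f g : ftame (fzend (f, g)) -> normal (f, g).
Proof.
case/tame_good=> psi [_ _ H _]; have N1 : normal id2.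
  exact/reduced_normal/reduced_aff/is_aff_id.
have [[f' g'] Ny E] := H _ N1.
suff -> : (f, g) = (f', g') by [].
congr (_, _); [have := E fX | have := E fY]; by rewrite /= zend_id (zendX, zendY) (zendX, zendY).
Qed.

Lemma tame_el q : fyz_only q -> ftame (fzend (el q)).
Proof.
move=> yq; apply: ftame_triangular; exists 1, 1, q, 0; split; rewrite ?oner_eq0 ?z_only0 //.
by rewrite /el !scale1r addr0.
Qed.

Lemma tame_swap : ftame (fzend (fY, fX)).
Proof.
apply: ftame_affine; exists (\matrix_(i, j) (i != j)%:R), 0, 0; split.
  by rewrite unitmx2 !mxE /= !mulr0 mulr1 sub0r oppr_eq0 oner_eq0.
by rewrite /flinear !mxE /= !scale0r !scale1r !addr0 add0r.
Qed.

Lemma tame_comp_right x y : ftame (fzend y) -> ftame (fzend x) -> ftame (fzend (pcomp x y)).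
Proof.
move=> ty tx; apply: ftame_ext (ftame_comp tx ty) => p /=; by rewrite zend_pcomp.
Qed.

Lemma tame_swapE f g : ftame (fzend (f, g)) <-> ftame (fzend (g, f)).
Proof.
have H f' g' : ftame (fzend (f', g')) -> ftame (fzend (g', f')).
  by move=> /(tame_comp_right tame_swap); rewrite /pcomp /= zendX zendY.
by split; apply: H.
Qed.

Lemma tame_elE f g q : fyz_only q ->
  ftame (fzend (f, g)) <-> ftame (fzend (f + fsubsty q g, g)).
Proof.
have H f' q' : fyz_only q' -> ftame (fzend (f', g)) -> ftame (fzend (f' + fsubsty q' g, g)).
  by move=> yq /(tame_comp_right (tame_el yq)); rewrite pcomp_el.
move=> yq; split; first exact: H.
have yN : fyz_only (- q) by apply: suppN.
move/(H _ _ yN); suff -> : fsubsty (- q) g = - fsubsty q g by rewrite addrK.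
by rewrite -scaleN1r /fsubsty zend_scale scaleN1r.
Qed.

End TameGroup.

(** * Reduction steps *)

Section Procedure.
Variables (K : fieldType) (F : free_model K).
Local Notation A := (fm_alg F).
Implicit Types (p q r f g h u v : A) (a b c d : K) (fg x y : A * A) (s t us : seq letter).
Local Notation Lt a := (@supp K F (fun s => (wbideg s < a)%O)).
Local Notation Le a := (@supp K F (fun s => (wbideg s <= a)%O)).
Local Notation linear_bideg := ((1%N, 0%N) : bdeg).

Lemma not_z_only_neq0 p : ~~ fz_only p -> p != 0.
Proof. by apply: contraNneq => ->; apply: z_only0. Qed.

Lemma not_z_only_bideg p : ~~ fz_only p -> (0 < (fbideg p).1)%N.
Proof. by rewrite z_onlyE lt0n. Qed.

Lemma hcomp_has_top p : p != 0 -> has_top (fbideg p) (fhcomp p) (fhcomp p).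
Proof. by case/has_topP=> Hu u0 _; split=> //; rewrite subrr supp0. Qed.

Lemma bideg_hcomp p : p != 0 -> fbideg (fhcomp p) = fbideg p.
Proof. by case/hcomp_has_top/has_topE. Qed.

Lemma hcompK p : p != 0 -> fhcomp (fhcomp p) = fhcomp p.
Proof. by case/hcomp_has_top/has_topE. Qed.

Lemma hcomp_xyhomog p : p != 0 -> fxyhomog (fbideg p).1 (fhcomp p).
Proof. by case/has_topP=> Hu _ _; apply: supp_sub Hu => s /eqP <-. Qed.

Lemma hcomp_neq0 p : p != 0 -> fhcomp p != 0.
Proof. by case/has_topP. Qed.

Lemma hcomp_supp P p : supp P p -> supp P (fhcomp p).
Proof.
move=> /allP Pp; rewrite /fhcomp big_seq_cond.
elim/big_ind: _ => [|? ?|w /andP[/Pp Pw _]]; [exact: supp0 | exact: suppD |].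
by apply: suppZ; rewrite basis_word; apply: supp_word.
Qed.

Lemma bideg_lt (a : bdeg) p : (0 < a.1)%N -> Lt a p -> (fbideg p < a)%O.
Proof.
move=> a0 La; have [->|p0] := eqVneq p 0.
  have := z_only0 F; rewrite z_onlyE ltnbP => /eqP ->; lia.
by have [w [w0 <-]] := bideg_attained p0; apply: (suppP _ _ La).
Qed.

Definition dominant fg := [/\ ~~ fz_only fg.2, (fbideg fg.2 < fbideg fg.1)%O &
  exists q n, [/\ (0 < n)%N, fyz_only q, fxyhomog n q,
    (fbideg fg.1).1 = ((fbideg fg.2).1 * n)%N & fhcomp fg.1 = fsubsty q (fhcomp fg.2)]].

Lemma hcomp_substy_neq0 q v : q != 0 -> fyz_only q -> v != 0 -> (0 < (fbideg v).1)%N ->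
  fxyhomog (fbideg v).1 v -> fsubsty (fhcomp q) v != 0.
Proof.
move=> q0 yq v0 dv Hv; apply: (substy_neq0 dv) => //.
- exact: hcomp_supp.
- exact: hcomp_xyhomog.
- exact: hcomp_neq0.
Qed.

Lemma el_dominant f g q : ~~ fz_only g -> (fbideg f <= fbideg g)%O -> fyz_only q ->
  (linear_bideg < fbideg q)%O -> dominant (f + fsubsty q g, g).
Proof.
move=> zg fg yq bq; have g0 := not_z_only_neq0 zg; have dg := not_z_only_bideg zg.
have q0 : q != 0.
  apply: contraTneq bq => ->; have := z_only0 F; rewrite z_onlyE ltnbP /= => /eqP ->; lia.
have yr : fyz_only (fhcomp q) by apply: hcomp_supp.
have nz : fsubsty (fhcomp q) (fhcomp g) != 0.
  by apply: hcomp_substy_neq0; rewrite ?hcomp_neq0 ?bideg_hcomp ?hcomp_xyhomog.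
have T := substy_top dg yq yr (has_topP q0) (has_topP g0) nz.
have lt_g : (fbideg g < bsubst (fbideg g) (fbideg q))%O.
  by move: bq dg; rewrite !ltnbP /=; nia.
have {}T : has_top (bsubst (fbideg g) (fbideg q)) (fsubsty (fhcomp q) (fhcomp g)) (f + fsubsty q g).
  rewrite addrC; apply: has_topD T _; apply: Le_Lt (Le_bideg f) _.
  exact: le_lt_trans lt_g.
have [bE hE] := has_topE T; split; rewrite /= ?bE //.
exists (fhcomp q), (fbideg q).1; rewrite hE mulnC; split=> //; last exact: hcomp_xyhomog.
by move: bq; rewrite ltnbP /=; lia.
Qed.

Lemma lin_top f g a b p : ~~ fz_only g -> (fbideg g < fbideg f)%O -> fz_only p ->
  (a != 0 -> has_top (fbideg f) (a *: fhcomp f) (a *: f + b *: g + p)) /\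
  (a = 0 -> b != 0 -> has_top (fbideg g) (b *: fhcomp g) (a *: f + b *: g + p)).
Proof.
move=> zg lt_gf zp; have dg := not_z_only_bideg zg.
have df : (0 < (fbideg f).1)%N by move: lt_gf dg; rewrite ltnbP; lia.
have g0 := not_z_only_neq0 zg.
have f0 : f != 0 by apply: not_z_only_neq0; rewrite z_onlyE -lt0n.
split=> [a0|-> b0]; last rewrite scale0r add0r.
  apply: has_topD; last exact: z_only_Lt.
  apply: has_topD; first exact/has_topZ/has_topP.
  exact/suppZ/(Le_Lt (Le_bideg g)).
by apply: has_topD; [exact/has_topZ/has_topP | exact: z_only_Lt].
Qed.

Lemma linear_neq0 a b : (a != 0) || (b != 0) -> a *: fX + b *: fY != 0 :> A.
Proof.
apply: contraTneq => E; rewrite negb_or !negbK.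
have /(congr1 (fm_coef (fm_mk F [:: lx]))) := E.
have /(congr1 (fm_coef (fm_mk F [:: ly]))) := E.
rewrite !coefD !coefZ !coef_word !coef0 !fm_mkK /= !mulr1 !mulr0 add0r addr0.
by move=> -> ->; rewrite eqxx.
Qed.

Lemma linear_has_top a b p : (a != 0) || (b != 0) -> fz_only p ->
  has_top linear_bideg (a *: fX + b *: fY) (a *: fX + b *: fY + p).
Proof.
move=> ab zp; split; rewrite ?linear_neq0 //.
  by apply: suppD; apply/suppZ/supp_word.
by rewrite addrAC subrr add0r; apply: z_only_Lt.
Qed.

Lemma aff_bideg c x : is_aff c x -> fbideg x.1 = linear_bideg /\ fbideg x.2 = linear_bideg.
Proof.
move=> [a [b [d [p [r [D zp zr ->]]]]]].
split; apply: (proj1 (has_topE (linear_has_top _ _))) => //; rewrite -negb_and.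
  by apply: contra D => /andP[/eqP -> /eqP ->]; rewrite !mul0r subrr.
by apply: contra D => /andP[/eqP -> /eqP ->]; rewrite !mulr0 subrr.
Qed.

Definition good_pair fg := (exists c, is_aff c fg) \/
  (exists x c y, [/\ dominant x, is_aff c y & fg = pcomp x y]).

Lemma good_aff_comp fg c y : good_pair fg -> is_aff c y -> good_pair (pcomp fg y).
Proof.
move=> [[c' ax]|[x [c' [z [Dx az ->]]]]] ay.
  by left; have [c'' ? _] := is_aff_comp ax ay; exists c''.
right; have [c'' ? _] := is_aff_comp az ay; exists x, c'', (pcomp z y).
by rewrite -pcompA.
Qed.

Lemma dominant_good x : dominant x -> good_pair x.
Proof. by move=> Dx; right; exists x, 0, (fX, fY); rewrite pcomp1; split=> //; apply: is_aff_id. Qed.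

Lemma reduced_good x : reduced x -> [/\ (fbideg x.1 <= fbideg x.2)%O, ~~ fz_only x.2 & good_pair x].
Proof.
elim=> {x} [c x ax|x q c y _ [le_x zx _] yq bq ay c0].
  have [-> E] := aff_bideg ax; rewrite z_onlyE E; split=> //; by left; exists c.
move: le_x zx; case: x => f g /= le_x zx.
have D : dominant (pcomp (f, g) (el q)) by rewrite pcomp_el //; apply: el_dominant.
have G : good_pair (pcomp (pcomp (f, g) (el q)) y) := good_aff_comp (dominant_good D) ay.
case: D ay => zg; move: G; case: (pcomp (f, g) (el q)) zg => {le_x zx} f' g' /= zg G lt_g _ ay.
move: G; case: ay c0 => a [b [d [p [r [_ zp zr ->]]]]] c0 G.
rewrite pcomp_aff //= in G *.
have [T _] := lin_top c d zg lt_g zr; have {}T := T c0; have [bE _] := has_topE T.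
have df : (0 < (fbideg f').1)%N by have := not_z_only_bideg zg; move: lt_g; rewrite ltnbP; lia.
case: (pcomp_aff f' g' a b c d zp zr) => E1 E2; rewrite /= E1 E2.
split=> //; last by rewrite z_onlyE bE -lt0n.
rewrite bE; apply: bideg_le; apply: suppD; last exact/Lt_Le/z_only_Lt.
apply: suppD; apply: suppZ; first exact: Le_bideg.
exact/Lt_Le/(Le_Lt (Le_bideg g')).
Qed.

Lemma normal_good x : normal x -> good_pair x.
Proof.
move=> [y [q [Ry yq ->]]]; have [le_y zy G] := reduced_good Ry.
have [bq|bq] := ltP linear_bideg (fbideg q); last exact: good_aff_comp (el_low yq bq).
case: y le_y zy {G Ry} => f g /= le_y zy.
by apply: dominant_good; rewrite pcomp_el //; apply: el_dominant.
Qed.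

Lemma good_presents f g : good_pair (f, g) -> (linear_bideg < fbideg f)%O ->
  (fbideg g <= fbideg f)%O -> exists q, fpresents 1 q (fhcomp f) (fhcomp g).
Proof.
case=> [[c /aff_bideg /= [-> _]]|]; first by rewrite ltxx.
move=> [[F' G'] [c [y [[/= zG lt_G [q [e [e0 yq Hq degE uE]]]] [a [b [d [p [r [D zp zr ->]]]]]]]]]].
rewrite pcomp_aff // => -[-> ->] {f g}.
have G0 := not_z_only_neq0 zG.
have F0 : F' != 0.
  apply: not_z_only_neq0; rewrite z_onlyE -lt0n.
  by have := not_z_only_bideg zG; move: lt_G; rewrite ltnbP; lia.
have [T1 T2] := lin_top a b zG lt_G zp; have [T3 T4] := lin_top c d zG lt_G zr.
have [a0|a0] := eqVneq a 0.
  have b0 : b != 0 by apply: contraNneq D => ->; rewrite a0 !mul0r subrr.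
  have c0 : c != 0 by apply: contraNneq D => ->; rewrite a0 mul0r mulr0 subrr.
  have [-> _] := has_topE (T2 a0 b0); have [-> _] := has_topE (T3 c0).
  by move=> _ /le_lt_trans /(_ lt_G); rewrite ltxx.
have {}T1 := T1 a0; have [bF hF] := has_topE T1; rewrite bF hF => lt_F le_g.
have degZ k h : k != 0 -> h != 0 -> fxydeg (k *: fhcomp h) = (fbideg h).1.
  move=> k0 h0; rewrite /fxydeg; suff [-> _] : fbideg (k *: fhcomp h) = fbideg h /\ fhcomp (k *: fhcomp h) = k *: fhcomp h by [].
  exact/has_topE/has_topZ/hcomp_has_top.
have [c0|c0] := eqVneq c 0.
  have d0 : d != 0 by apply: contraNneq D => ->; rewrite c0 !mulr0 subrr.
  have [_ ->] := has_topE (T4 c0 d0); have dinv : d^-1 != 0 by rewrite invr_neq0.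
  suff [q' P] : exists q', fpresents d q' (a *: fhcomp F') (d *: fhcomp G').
    exact: presents_rescale (oner_neq0 _) P.
  exists (a *: q), e; split=> //; first by rewrite !degZ.
    by apply/andP; split; apply: suppZ.
  by rewrite scalerA mulVf // scale1r /fsubsty zend_scale -/(fsubsty _ _) uE.
have [_ ->] := has_topE (T3 c0).
suff [q' P] : exists q', fpresents c q' (a *: fhcomp F') (c *: fhcomp F').
  exact: presents_rescale (oner_neq0 _) P.
exists (a *: fY), 1%N; split=> //; first by rewrite !degZ // muln1.
  by apply/andP; split; apply/suppZ/supp_word.
by rewrite scalerA mulVf // scale1r /fsubsty zend_scale zendY.
Qed.

Lemma presents_lt f g c q : ~~ fz_only f -> ~~ fz_only g ->
  fpresents c q (fhcomp f) (fhcomp g) -> (fbideg (f - fsubsty q (c^-1 *: g)) < fbideg f)%O.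
Proof.
move=> zf zg [n [n0 degE c0 /andP[yq Hq] uE]].
have f0 := not_z_only_neq0 zf; have g0 := not_z_only_neq0 zg.
have dg := not_z_only_bideg zg; have cV : c^-1 != 0 by rewrite invr_neq0.
have q0 : q != 0.
  by apply: contraNneq (hcomp_neq0 f0) => q0; rewrite uE q0 /fsubsty zend0.
have Tg := has_topZ cV (has_topP g0); have Tv := has_topZ cV (hcomp_has_top g0).
have [bv _] := has_topE Tv.
have yr : fyz_only (fhcomp q) by apply: hcomp_supp.
have nz : fsubsty (fhcomp q) (c^-1 *: fhcomp g) != 0.
  apply: hcomp_substy_neq0; rewrite ?bv //; first by case: Tv.
  exact/suppZ/hcomp_xyhomog.
have [b1 h1] := has_topE (substy_top dg yq yr (has_topP q0) Tv nz).
have T2 := substy_top dg yq yr (has_topP q0) Tg nz.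
rewrite -uE in b1 h1; rewrite -h1 hcompK // -b1 bideg_hcomp // in T2.
apply: bideg_lt; first exact: not_z_only_bideg.
have [_ _ L1] := has_topP f0; have [_ _ L2] := T2.
rewrite (_ : _ - _ = (f - fhcomp f) - (fsubsty q (c^-1 *: g) - fhcomp f)); first exact: suppB.
by rewrite opprB addrA subrK.
Qed.

Lemma tame_presents f g c q u v : fpresents c q u v ->
  ftame (fzend (f, g)) <-> ftame (fzend (f - fsubsty q (c^-1 *: g), g)).
Proof.
move=> [n [n0 degE c0 /andP[yq Hq] uE]].
have yq' : fyz_only (- (c^-1 ^+ n *: q)) by apply/suppN/suppZ.
rewrite (tame_elE f g yq') (substy_scale _ _ yq Hq).
suff -> : fsubsty (- (c^-1 ^+ n *: q)) g = - (c^-1 ^+ n *: fsubsty q g) by [].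
by rewrite -scaleNr /fsubsty zend_scale scaleNr.
Qed.

Lemma reduction_step f g : ~~ fz_only f -> ~~ fz_only g ->
  (linear_bideg < fbideg (fhcomp f))%O -> (fbideg (fhcomp g) <= fbideg (fhcomp f))%O ->
  (forall c, c != 0 ->
      (ffind_q c (fhcomp f) (fhcomp g) <-> exists c' q, fpresents c' q (fhcomp f) (fhcomp g))
      /\ (forall q, ffind_q c (fhcomp f) (fhcomp g) = Some q <->
                    fpresents c q (fhcomp f) (fhcomp g)))
  /\ (forall c q, fpresents c q (fhcomp f) (fhcomp g) ->
        (ftame (fzend (f, g)) <-> ftame (fzend (f - fsubsty q (c^-1 *: g), g))))
  /\ (~ (exists c q, fpresents c q (fhcomp f) (fhcomp g)) -> ~ ftame (fzend (f, g))).
Proof.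
move=> zf zg; have f0 := not_z_only_neq0 zf; have g0 := not_z_only_neq0 zg.
rewrite !bideg_hcomp // => bf bg.
have findE c q : c != 0 -> ffind_q c (fhcomp f) (fhcomp g) = Some q <->
                    fpresents c q (fhcomp f) (fhcomp g).
  move=> c0; split; first exact: find_q_presents.
  apply: presents_find_q; rewrite ?hcomp_neq0 // /fxydeg ?bideg_hcomp ?hcomp_xyhomog //.
  exact: not_z_only_bideg.
split; last split.
- move=> c c0; split; last by move=> q; apply: findE.
  split=> [|[c' [q /(presents_rescale c0)[q' /(findE _ _ c0) -> //]]]].
  by case E : (ffind_q _ _ _) => [q|] // _; exists c, q; apply/findE.
- by move=> c q P; apply: tame_presents P.
- move=> nP /tame_normal/normal_good/good_presents /(_ bf bg)[q P]; case: nP.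
  by exists 1, q.
Qed.

Lemma top_linear f : fbideg (fhcomp f) = linear_bideg ->
  exists a b p, [/\ (a != 0) || (b != 0), fz_only p, f = a *: fX + b *: fY + p &
    fhcomp f = a *: fX + b *: fY].
Proof.
have [->|f0] := eqVneq f 0.
  have h0 : fhcomp (0 : A) = 0.
    by rewrite /fhcomp big1_seq // => w /andP[_]; rewrite fm_mem_supp coef0 eqxx.
  by have := z_only0 F; rewrite h0 z_onlyE => /[swap] ->.
rewrite bideg_hcomp // => bf.
have Lf : Le linear_bideg f by rewrite -bf; apply: Le_bideg.
have [a [b [p [zp fE]]]] := linear_form Lf; exists a, b, p.
have ab : (a != 0) || (b != 0).
  rewrite -negb_and; apply/negP => /andP[/eqP a0 /eqP b0].
  by move: zp; rewrite z_onlyE; move: fE; rewrite a0 b0 !scale0r !add0r => <-; rewrite bf.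
by split=> //; rewrite fE; apply: (proj2 (has_topE (linear_has_top ab zp))).
Qed.

Definition flin_indep u v : Prop := forall a b, a *: u + b *: v = 0 -> a = 0 /\ b = 0.

Lemma lin_indep_det a b c d : flin_indep (a *: fX + b *: fY : A) (c *: fX + d *: fY) <->
  a * d - b * c != 0.
Proof.
have lin (k l : K) : k *: (a *: fX + b *: fY) + l *: (c *: fX + d *: fY) =
    (k * a + l * c) *: fX + (k * b + l * d) *: fY :> A.
  by rewrite !scalerDr !scalerA !scalerDl [LHS](AC (2*2) (1*3*(2*4))).
have lin0 (k l : K) : k *: fX + l *: fY = 0 :> A <-> k = 0 /\ l = 0.
  split=> [E|[-> ->]]; last by rewrite !scale0r addr0.
  have : ~~ ((k != 0) || (l != 0)) by apply/negP => /linear_neq0; rewrite E eqxx.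
  by rewrite negb_or !negbK => /andP[/eqP -> /eqP ->].
split=> [ind|D k l]; last first.
  rewrite lin => /lin0[E1 E2]; split; apply/eqP.
    have : k * (a * d - b * c) = d * (k * a + l * c) - c * (k * b + l * d) by ring.
    by rewrite E1 E2 !mulr0 subr0 => /eqP; rewrite mulf_eq0 (negbTE D) orbF.
  have : l * (a * d - b * c) = a * (k * b + l * d) - b * (k * a + l * c) by ring.
  by rewrite E1 E2 !mulr0 subr0 => /eqP; rewrite mulf_eq0 (negbTE D) orbF.
apply/negP => /eqP D.
have [|d0 b0] := ind d (- b); first by rewrite lin; apply/lin0; split; [rewrite -[RHS]D|]; ring.
have [|c0 a0] := ind c (- a); first by rewrite lin; apply/lin0; split; [|rewrite -[RHS]oppr0 -D]; ring.
move/eqP: b0; rewrite oppr_eq0 => /eqP b0; move/eqP: a0; rewrite oppr_eq0 => /eqP a0.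
have [|/eqP] := ind 1 0; last by rewrite oner_eq0.
by rewrite a0 b0 !scale0r !addr0 scaler0.
Qed.

End Procedure.

Lemma bdeg_ind (P : bdeg -> Prop) :
  (forall a, (forall a', (a' < a)%O -> P a') -> P a) -> forall a, P a.
Proof.
move=> IH [m n]; elim/ltn_ind: m n => m IHm; elim/ltn_ind => n IHn.
apply: IH => -[m' n']; rewrite ltnbP /= => /orP[/IHm //|/andP[/eqP -> /IHn //]].
Qed.

Section Decision.
Variables (K : fieldType) (F : free_model K).
Local Notation A := (fm_alg F).
Implicit Types (p q r f g h u v : A) (a b c d : K) (fg : A * A).
Local Notation linear_bideg := ((1%N, 0%N) : bdeg).

Lemma z_onlyX : @fz_only K F fX = false.
Proof. by rewrite /fz_only /supp supp_fword /= fm_mkK. Qed.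

Lemma z_onlyY : @fz_only K F fY = false.
Proof. by rewrite /fz_only /supp supp_fword /= fm_mkK. Qed.

Lemma z_only_not_inj f g : fz_only f \/ fz_only g -> ~ injective (fzend (f, g)).
Proof.
move=> zfg inj; case: zfg => z.
  have /inj E : fzend (f, g) fX = fzend (f, g) f by rewrite zendX zend_z_only.
  by have := z_onlyX; rewrite E z.
have /inj E : fzend (f, g) fY = fzend (f, g) g by rewrite zendY zend_z_only.
by have := z_onlyY; rewrite E z.
Qed.

Lemma inj_det a b c d p r : (a != 0) || (b != 0) -> fz_only p -> fz_only r ->
  injective (fzend (a *: fX + b *: fY + p, c *: fX + d *: fY + r : A)) ->
  a * d - b * c != 0.
Proof.
move=> ab zp zr inj; apply/negP => /eqP D.
have key k l : k * a + l * c = 0 -> k * b + l * d = 0 -> k = 0 /\ l = 0.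
  move=> E1 E2; have zs : fz_only (k *: p + l *: r) by apply: suppD; apply: suppZ.
  have /inj E : fzend (a *: fX + b *: fY + p, c *: fX + d *: fY + r) (k *: fX + l *: fY)
      = fzend (a *: fX + b *: fY + p, c *: fX + d *: fY + r) (k *: p + l *: r).
    rewrite [RHS]zend_z_only // zendD !zend_scale zendX zendY /= !scalerDr !scalerA.
    rewrite [LHS](AC (3*3) ((1*4)*(2*5)*(3*6))) /= -!scalerDl E1 E2 !scale0r !add0r //.
  have : ~~ ((k != 0) || (l != 0)).
    apply/negP => kl; have [bE _] := has_topE (linear_has_top kl (z_only0 F)).
    by move: zs; rewrite z_onlyE -E -[_ + l *: _]addr0 bE.
  by rewrite negb_or !negbK => /andP[/eqP -> /eqP ->].
have [||d0 /eqP] := key d (- b); [by rewrite -D; ring | by ring |].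
rewrite oppr_eq0 => /eqP b0.
have [||c0 /eqP] := key c (- a); [by ring | by rewrite -[RHS]oppr0 -D; ring |].
by rewrite oppr_eq0 => a0; move: ab; rewrite a0 b0 eqxx.
Qed.

Lemma aff_factor a b c d p r (m : 'M[K]_2 := \matrix_(i, j)
    (if i == 0 then if j == 0 then a else c else if j == 0 then b else d)) : fz_only p -> fz_only r ->
  fzend (a *: fX + b *: fY + p, c *: fX + d *: fY + r : A) =1
    fzend (flinear F m) \o fzend (fX + p, fY + r).
Proof.
move=> zp zr x; rewrite /= zend_comp /= !zendD zendX zendY (zend_z_only _ zp) (zend_z_only _ zr).
by rewrite /flinear /m !mxE.
Qed.

Lemma aff_tame a b c d p r : a * d - b * c != 0 -> fz_only p -> fz_only r ->
  ftame (fzend (a *: fX + b *: fY + p, c *: fX + d *: fY + r : A)).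
Proof.
move=> D zp zr; apply: ftame_ext (fun x => esym (aff_factor a b c d zp zr x)) _.
apply: ftame_comp.
  apply: ftame_affine; eexists _, 0, 0; split; last first.
    by rewrite !mxE !scale0r !addr0 -surjective_pairing.
  by rewrite unitmx2 !mxE.
apply: ftame_triangular; exists 1, 1, p, r.
by rewrite !scale1r oner_eq0; split=> //; apply: z_only_yz_only.
Qed.

Lemma linear_step f g : fbideg (fhcomp f) = linear_bideg -> fbideg (fhcomp g) = linear_bideg ->
  (flin_indep (fhcomp f) (fhcomp g) ->
     exists (a : 'M[K]_2) (p r : A),
       [/\ a \in unitmx, fz_only p, fz_only r &
           fzend (f, g) =1 fzend (flinear F a) \o fzend (fX + p, fY + r)])
  /\ (~ flin_indep (fhcomp f) (fhcomp g) -> ~ bijective (fzend (f, g))).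
Proof.
move=> /top_linear[a [b [p [ab zp -> ->]]]] /top_linear[c [d [r [_ zr -> ->]]]].
rewrite lin_indep_det; split=> [D|nD /bij_inj /(inj_det ab zp zr) //].
by eexists _, p, r; split; [|exact: zp|exact: zr|exact: aff_factor]; rewrite unitmx2 !mxE.
Qed.

Definition fstep b fg : bool + A * A :=
  let: (f, g) := fg in
  let u := fhcomp f in
  let v := fhcomp g in
  if fz_only f || fz_only g then inl false
  else if (fbideg u == (1%N, 0%N)) && (fbideg v == (1%N, 0%N)) then
    inl (fm_coef (fm_mk F [:: lx]) u * fm_coef (fm_mk F [:: ly]) v
      != fm_coef (fm_mk F [:: ly]) u * fm_coef (fm_mk F [:: lx]) v)
  else if (fbideg v <= fbideg u)%O then
    if ffind_q b u v is Some q then inr (f - fsubsty q (b^-1 *: g), g)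
    else inl false
  else
    if ffind_q b v u is Some q then inr (f, g - fsubsty q (b^-1 *: f))
    else inl false.

Fixpoint frun (b : nat -> K) (n : nat) fg : option bool :=
  if n is n'.+1 then
    match fstep (b 0%N) fg with
    | inl answer => Some answer
    | inr fg' => frun (fun i => b i.+1) n' fg'
    end
  else None.

Lemma frunS (b : nat -> K) n fg : frun b n.+1 fg = match fstep (b 0%N) fg with
  | inl answer => Some answer
  | inr fg' => frun (fun i => b i.+1) n fg'
  end.
Proof. by []. Qed.

Lemma linear_det f g : fbideg (fhcomp f) = linear_bideg -> fbideg (fhcomp g) = linear_bideg ->
  (fm_coef (fm_mk F [:: lx]) (fhcomp f) * fm_coef (fm_mk F [:: ly]) (fhcomp g)
    != fm_coef (fm_mk F [:: ly]) (fhcomp f) * fm_coef (fm_mk F [:: lx]) (fhcomp g))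
  <-> ftame (fzend (f, g)).
Proof.
move=> /top_linear[a [b [p [ab zp -> ->]]]] /top_linear[c [d [r [_ zr -> ->]]]].
rewrite !coefD !coefZ !coef_word !fm_mkK /= !mulr1 !mulr0 !add0r !addr0 -subr_eq0.
by split=> [D|/tame_bij/bij_inj]; [exact: aff_tame | exact: inj_det].
Qed.

Lemma linear_lt f : ~~ fz_only f -> (fbideg f == linear_bideg) = false ->
  (linear_bideg < fbideg f)%O.
Proof.
by rewrite z_onlyE => f0 bf; rewrite lt_neqAle eq_sym bf leqbP /=; case: (fbideg f).1 f0 => [|[|n]].
Qed.

Lemma run_tame f g (b : nat -> K) : (forall i, b i != 0) ->
  exists (n : nat) (answer : bool),
    frun b n (f, g) = Some answer /\ (answer <-> ftame (fzend (f, g))).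
Proof.
move Ef: (fbideg f) => df; elim/bdeg_ind: df f g b Ef => df IHf f g b Ef.
move Eg: (fbideg g) => dg; elim/bdeg_ind: dg g b Eg => dg IHg g b Eg b0.
suff [[ans [E1 E2]]|[f' [g' [n [ans [E1 E2 E3]]]]]] :
    (exists ans : bool, fstep (b 0%N) (f, g) = inl ans /\ (ans <-> ftame (fzend (f, g)))) \/
    (exists f' g' n (ans : bool), [/\ fstep (b 0%N) (f, g) = inr (f', g'),
       frun (fun i => b i.+1) n (f', g') = Some ans & ans <-> ftame (fzend (f, g))]).
- by exists 1%N, ans; rewrite frunS E1.
- by exists n.+1, ans; rewrite frunS E1.
rewrite /fstep; case: ifP => [zfg|/norP[zf zg]].
  left; exists false; split=> //; split=> // /tame_bij/bij_inj /z_only_not_inj; case.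
  by case/orP: zfg; [left | right].
have f0 := not_z_only_neq0 zf; have g0 := not_z_only_neq0 zg.
case: ifP => [/andP[/eqP bu /eqP bv]|lin].
  by left; eexists; split; [reflexivity | exact: linear_det].
have swapE x y : ftame (fzend (x, y)) <-> ftame (fzend (y, x)) by apply: tame_swapE.
case: ifP => [le_vu|/negbT]; last rewrite -ltNge => lt_uv.
  have lt_u : (linear_bideg < fbideg (fhcomp f))%O.
    rewrite bideg_hcomp //; apply: linear_lt => //; apply/eqP => bf.
    move: lin le_vu; rewrite !bideg_hcomp // bf eqxx /= => /eqP bg; rewrite leqbP /= => le_g.
    apply: bg; have := not_z_only_bideg zg; case: (fbideg g) le_g => m n /= le_g m0.
    by congr pair; lia.
  have [findE [tameE nP]] := reduction_step zf zg lt_u le_vu.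
  have [someE qE] := findE _ (b0 0%N).
  case E : ffind_q => [q|]; last first.
    left; exists false; split=> //; split=> // T; case: nP => //.
    by move/someE; rewrite E.
  right; move/qE: E => P; exists (f - fsubsty q ((b 0%N)^-1 *: g)), g.
  have [n [ans [R1 R2]]] := IHf _ (eq_ind _ (fun x => (_ < x)%O) (presents_lt zf zg P) _ Ef)
    _ g (fun i => b i.+1) erefl (fun i => b0 i.+1).
  by exists n, ans; split=> //; rewrite R2; apply: iff_sym; apply: tameE.
have lt_v : (linear_bideg < fbideg (fhcomp g))%O.
  apply: le_lt_trans lt_uv; rewrite bideg_hcomp //.
  by have := not_z_only_bideg zf; rewrite leqbP /=; lia.
have [findE [tameE nP]] := reduction_step zg zf lt_v (ltW lt_uv).
have [someE qE] := findE _ (b0 0%N).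
case E : ffind_q => [q|]; last first.
  left; exists false; split=> //; split=> // /swapE T; case: nP => //.
  by move/someE; rewrite E.
right; move/qE: E => P; exists f, (g - fsubsty q ((b 0%N)^-1 *: f)).
have [n [ans [R1 R2]]] := IHg _ (eq_ind _ (fun x => (_ < x)%O) (presents_lt zg zf P) _ Eg)
  _ (fun i => b i.+1) erefl (fun i => b0 i.+1).
exists n, ans; split=> //; rewrite R2 swapE; apply: iff_sym; rewrite swapE; exact: tameE.
Qed.

End Decision.

(** * The model freeAlg *)

Section ConcreteModel.
Variable K : fieldType.
Local Notation wmon := (fmonom 'I_3).
Local Notation A := (freeAlg K).
Implicit Types (p q : A) (c : K).

Lemma mulr_malgC c p : p * malgC c = c *: p.
Proof.
rewrite monalg.malgM_def fgmulgU monalg.malgZ_def.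
by apply: eq_bigr => w _; rewrite mulrC mulm1.
Qed.

Lemma malg_scalerAl c p q : c *: (p * q) = (c *: p) * q.
Proof. exact: scalerAl. Qed.

Lemma malg_scalerAr c p q : c *: (p * q) = p * (c *: q).
Proof.
by rewrite malg_scalerAl -mulr_malgC -mulrA; congr (_ * _); apply: mul_malgC.
Qed.

(* Not inferred canonically: for the key [malg], the algebra structure of *)
(* the library is reserved to commutative monoids.                        *)
Definition freeAlg_algType : algType K :=
  HB.pack A (GRing.Lalgebra_isAlgebra.Build K A malg_scalerAr).

Fact malg_mkK : cancel (@FMonom 'I_3) (@fmonom_val 'I_3).
Proof. by []. Qed.

Fact malg_seqK : cancel (@fmonom_val 'I_3) (@FMonom 'I_3).
Proof. exact: fmK. Qed.

Fact malg_uniq p : uniq (monalg.msupp p).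
Proof. exact: fset_uniq. Qed.

Fact malg_mem p (w : wmon) : (w \in (monalg.msupp p : seq wmon)) = (monalg.mcoeff w p != 0).
Proof. by rewrite mcoeff_neq0. Qed.

Fact malg_linear (w : wmon) c p q :
  monalg.mcoeff w (c *: p + q) = c * monalg.mcoeff w p + monalg.mcoeff w q.
Proof. by rewrite monalg.mcoeffD monalg.mcoeffZ. Qed.

Fact malg_basis (v w : wmon) : monalg.mcoeff w (mkmalgU v 1 : A) = (v == w)%:R.
Proof. exact: monalg.mcoeffU. Qed.

Fact malg_expand p :
  p = \sum_(w <- monalg.msupp p) monalg.mcoeff w p *: (mkmalgU w 1 : A).
Proof.
rewrite [LHS]monalgE; apply: eq_bigr => w _; apply/malgP => x.
by rewrite monalg.mcoeffZ (monalg.mcoeffU w) (monalg.mcoeffU w (1 : K)) mulr_natr.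
Qed.

Fact malg_nil : mkmalgU (FMonom [::]) 1 = 1 :> A.
Proof. by rewrite -fmoneE. Qed.

Fact malg_cat (s t : seq letter) :
  mkmalgU (FMonom (s ++ t)) 1 = mkmalgU (FMonom s) 1 * mkmalgU (FMonom t) 1 :> A.
Proof. by rewrite monalg.malgM_def fgmulUU mulr1 /mmul /= fmmulE. Qed.

Definition freeAlg_model : free_model K :=
  @FreeModel K freeAlg_algType wmon (@fmonom_val 'I_3) (@FMonom 'I_3)
    (fun w => mkmalgU w 1) monalg.mcoeff monalg.msupp
    malg_mkK malg_seqK malg_uniq malg_mem malg_linear malg_basis malg_expand
    malg_nil malg_cat.

Local Notation F := freeAlg_model.

Lemma hcompM p : hcomp p = @fhcomp K F p.
Proof. by []. Qed.

Lemma find_qM c p q : find_q c p q = @ffind_q K F c p q.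
Proof. by []. Qed.

Lemma stepM c fg : step c fg = @fstep K F c fg.
Proof. case: fg => f g; rewrite /step /fstep 2!find_qM 2!hcompM. exact: erefl. Qed.

Lemma runM b n fg : run b n fg = @frun K F b n fg.
Proof.
elim: n b fg => [|n IH] b fg; first exact: erefl.
have -> : run b n.+1 fg = match step (b 0%N) fg with
  | inl answer => Some answer | inr fg' => run (fun i => b i.+1) n fg' end by exact: erefl.
rewrite frunS stepM; case: (@fstep K F (b 0%N) fg) => [ans|fg']; first exact: erefl.
exact: IH.
Qed.

Lemma z_tameM phi : z_tame phi <-> @ftame K F phi.
Proof.
split; elim=> {phi} [fg H|fg H||phi psi _ H1 _ H2|phi psi _ H c1 c2|phi psi E _ H].
- exact: (@ftame_affine K F).
- exact: (@ftame_triangular K F).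
- exact: (@ftame_id K F).
- exact: (@ftame_comp K F).
- exact: (@ftame_inv K F _ _ H c1 c2).
- exact: (@ftame_ext K F _ _ E H).
- exact: z_tame_affine.
- exact: z_tame_triangular.
- exact: z_tame_id.
- exact: z_tame_comp.
- exact: z_tame_inv c1 c2.
- exact: z_tame_ext H.
Qed.

End ConcreteModel.

Theorem mainTheorem2 (K : fieldType)
    (phi : {lrmorphism freeAlg K -> freeAlg K}) (phiZ : phi Z = Z) :
  let f := phi X in
  let g := phi Y in
  let u := hcomp f in
  let v := hcomp g in
  (* In Steps 2 and 3, and in the final clause, a negative answer is that  *)
  (* phi is not a z-tame automorphism: z-wild automorphisms also end there. *)
  (* Step 0 *)
  (z_only f \/ z_only g -> ~ bijective phi)
  /\
  (~~ z_only f -> ~~ z_only g ->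
   (* Step 1 *)
   (bideg u = (1%N, 0%N) -> bideg v = (1%N, 0%N) ->
      (lin_indep u v ->
         exists (a : 'M[K]_2) (p r : freeAlg K),
           [/\ a \in unitmx, z_only p, z_only r &
               phi =1 zend (z_linear a) \o zend (X + p, Y + r)])
      /\ (~ lin_indep u v -> ~ bijective phi))
   /\
   (* Step 2 *)
   ((((1%N, 0%N) : nat *l nat) < bideg u)%O -> (bideg v <= bideg u)%O ->
      (forall b : K, b != 0 ->
         (find_q b u v <-> exists b' q, presents b' q u v)
         /\ (forall q, find_q b u v = Some q <-> presents b q u v))
      /\ (forall b q, presents b q u v ->
            (z_tame phi <-> z_tame (zend (f - substy q (b^-1 *: g), g))))
      /\ (~ (exists b q, presents b q u v) -> ~ z_tame phi))
   /\
   (* Step 3 *)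
   ((((1%N, 0%N) : nat *l nat) < bideg v)%O -> (bideg u < bideg v)%O ->
      (forall a : K, a != 0 ->
         (find_q a v u <-> exists a' q, presents a' q v u)
         /\ (forall q, find_q a v u = Some q <-> presents a q v u))
      /\ (forall a q, presents a q v u ->
            (z_tame phi <-> z_tame (zend (f, g - substy q (a^-1 *: f)))))
      /\ (~ (exists a q, presents a q v u) -> ~ z_tame phi)))
  /\
  (* The whole procedure halts and decides z-tameness *)
  (forall b : nat -> K, (forall i, b i != 0) ->
     exists (n : nat) (answer : bool),
       run b n (f, g) = Some answer /\ (answer <-> z_tame phi)).
Proof.
move=> f g u v; set F := freeAlg_model K.
have E : phi =1 @fzend K F (f, g).
  apply: (@zendP K F phi) phiZ; first exact: linearP.
  by split; [exact: rmorph1 | exact: rmorphM].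
have tE : z_tame phi <-> @ftame K F (@fzend K F (f, g)).
  apply: iff_trans (z_tameM _) _.
  by split; apply: (@ftame_ext K F) => // x; rewrite E.
have swapE x y : @ftame K F (@fzend K F (x, y)) <-> @ftame K F (@fzend K F (y, x)).
  exact: (@tame_swapE K F).
split; [|split].
- move=> zfg /bij_inj inj; apply: (@z_only_not_inj K F f g zfg).
  exact: eq_inj inj E.
- move=> zf zg; split; [|split].
  + move=> bu bv; have [S1 S2] := @linear_step K F f g bu bv; split.
      move=> /S1[a [p [r [ua zp zr H]]]]; exists a, p, r; split; [exact: ua|exact: zp|exact: zr|].
      by move=> x; rewrite E; apply: H.
    by move=> nI bij; apply: (S2 nI); apply: eq_bij bij _ E.
  + move=> bu bv; have [S1 [S2 S3]] := @reduction_step K F f g zf zg bu bv.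
    split; [|split].
    * move=> b b0; have [P1 P2] := S1 b b0; rewrite find_qM; split; [exact: P1 | exact: P2].
    * move=> b q P; apply: iff_trans tE _; apply: iff_trans (S2 b q P) _.
      exact: (iff_sym (z_tameM _)).
    * move=> nP /tE T; exact: (S3 nP T).
  + move=> bu bv; have [S1 [S2 S3]] := @reduction_step K F g f zg zf bu (ltW bv).
    split; [|split].
    * move=> b b0; have [P1 P2] := S1 b b0; rewrite find_qM; split; [exact: P1 | exact: P2].
    * move=> b q P; apply: iff_trans tE _; apply: iff_trans (swapE _ _) _.
      apply: iff_trans (S2 b q P) _; apply: iff_trans (swapE _ _) _.
      exact: (iff_sym (z_tameM _)).
    * move=> nP /tE /swapE T; exact: (S3 nP T).
- move=> b b0; have [n [ans [R1 R2]]] := @run_tame K F f g b b0; exists n, ans.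
  split; first by rewrite runM; exact: R1.
  exact: iff_trans R2 (iff_sym tE).
Qed.
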